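(* Let $n\in\mathbb N$ and let $\Phi=\{\varphi_m\}_{m=1}^\infty$ be a family of nondecreasing continuous functions $\varphi_m:[0,\infty)\to\mathbb R$ such that for each $m\in\mathbb N$: ($i_1$) $\lim_{x\to+\infty}\varphi_m(x)/x=+\infty$; ($i_2$) for each $A>0$ there is a constant $C(m,A)>0$ with $\varphi_m(x)+A\ln(1+x)\le\varphi_{m+1}(x)+C(m,A)$ for all $x\ge0$; ($i_4$) there exist constants $\sigma_m>1$ and $\gamma_m>0$ such that $\varphi_m(\sigma_m x)\le\varphi_{m+1}(x)+\gamma_m$ for all $x\ge 0$. Then each function $f\in\mathcal E(\Psi^* )$ admits a (unique) extension to an entire function on $\mathbb C^n$, and this extension belongs to $E(\Phi)$.
   Context: $\|\cdot\|$ is the Euclidean norm on $\mathbb R^n$ or $\mathbb C^n$; $H(\mathbb C^n)$ is the space of entire functions on $\mathbb C^n$. For $\alpha\in\mathbb Z_+^n$, $|\alpha|=\alpha_1+\dots+\alpha_n$, $\alpha!=\alpha_1!\cdots\alpha_n!$, $D^\alpha=\partial^{|\alpha|}/\partial x_1^{\alpha_1}\cdots\partial x_n^{\alpha_n}$. Functions on $\mathbb R^n$ are complex-valued. For $\nu\in\mathbb N$, $k\in\mathbb Z_+$ let $$E_k(\varphi_\nu)=\Big\{f\in H(\mathbb C^n):\ p_{\nu,k}(f)=\sup_{z\in\mathbb C^n}\frac{|f(z)|(1+\|z\|)^k}{e^{\varphi_\nu(\|\operatorname{Im}z\|)}}<\infty\Big\},$$ $E(\varphi_\nu)=\bigcap_{k=0}^\infty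 E_k(\varphi_\nu)$, $E(\Phi)=\bigcup_{\nu=1}^\infty E(\varphi_\nu)$. For a continuous $g:[0,\infty)\to\mathbb R$ with $g(x)/x\to+\infty$ as $x\to+\infty$, the Young conjugate is $g^*(x)=\sup_{y\ge0}(xy-g(y))$, $x\ge0$. Put $\psi_\nu(x)=\varphi_\nu(e^x)$ for $x\ge0$, and $\Psi^*=\{\psi_\nu^*\}_{\nu=1}^\infty$. For $\nu\in\mathbb N$, $m\in\mathbb Z_+$ let $$\mathcal E_m(\psi_\nu^* )=\Big\{f\in C^\infty(\mathbb R^n):\ \sup_{x\in\mathbb R^n,\ \alpha\in\mathbb Z_+^n}\frac{(1+\|x\|)^m|(D^\alpha f)(x)|}{\alpha!\,e^{-\psi_\nu^*(|\alpha|)}}<\infty\Big\},$$ $\mathcal E(\psi_\nu^* )=\bigcap_{m=0}^\infty\mathcal E_m(\psi_\nu^* )$, $\mathcal E(\Psi^* )=\bigcup_{\nu=1}^\infty\mathcal E(\psi_\nu^* )$. *)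

(* Defs.v *)
From HB Require Import structures.
From mathcomp Require Import all_boot all_order all_algebra.
From mathcomp Require Import all_classical all_reals all_analysis.
From mathcomp Require Import complex.

Set Implicit Arguments.
Unset Strict Implicit.
Unset Printing Implicit Defensive.

Import Order.TTheory GRing.Theory Num.Theory.
Import numFieldNormedType.Exports.

Local Open Scope classical_set_scope.
Local Open Scope ring_scope.
Local Open Scope complex_scope.

(* The library norm on row vectors is the max-norm (it only provides the
   topology here), hence explicit Euclidean norms. [Normc.normc] is the complex
   modulus with values in [R] (whereas [`|z|] lives in [R[i]]). *)
Definition enorm (R : realType) (n : nat) (x : 'rV[R]_n) : R :=
  Num.sqrt (\sum_(i < n) x 0 i ^+ 2).

Definition cenorm (R : realType) (n : nat) (z : 'rV[R[i]]_n) : R :=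
  Num.sqrt (\sum_(i < n) Normc.normc (z 0 i) ^+ 2).

Definition imvec (R : realType) (n : nat) (z : 'rV[R[i]]_n) : 'rV[R]_n :=
  \row_(i < n) complex.Im (z 0 i).

Definition cembed (R : realType) (n : nat) (x : 'rV[R]_n) : 'rV[R[i]]_n :=
  \row_(i < n) (x 0 i)%:C.

(* Frechet differentiability over [K] at every point; it is used with
   [K := R[i]], where it means complex differentiability on C^n. It is stated
   over an abstract [K] because [R[i]] itself carries no declared topology:
   the one used is that of the norm [`|z|] of the [numFieldType] [R[i]]. *)
Definition entire (K : numFieldType) (n : nat) (F : 'rV[K]_n -> K) : Prop :=
  forall z : 'rV[K]_n, differentiable F z.

Definition extends (R : realType) (n : nat)
    (F : 'rV[R[i]]_n -> R[i]) (f : 'rV[R]_n -> R[i]) : Prop :=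
  forall x : 'rV[R]_n, F (cembed x) = f x.

Definition pnorm (R : realType) (n : nat) (phi : R -> R) (k : nat)
    (F : 'rV[R[i]]_n -> R[i]) : \bar R :=
  ereal_sup [set (Normc.normc (F z) * (1 + cenorm z) ^+ k
                  / expR (phi (enorm (imvec z))))%:E | z in setT].

Definition E_k (R : realType) (n : nat) (phi : R -> R) (k : nat) :
    set ('rV[R[i]]_n -> R[i]) :=
  [set F | entire F /\ (pnorm phi k F < +oo)%E].

Definition E_weight (R : realType) (n : nat) (phi : R -> R) :
    set ('rV[R[i]]_n -> R[i]) :=
  \bigcap_k E_k phi k.

(* Families are indexed by the positive integers; the term of index 0 of a
   sequence [nat -> _] is never used. *)
Definition E_family (R : realType) (n : nat) (Phi : nat -> R -> R) :
    set ('rV[R[i]]_n -> R[i]) :=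
  \bigcup_(nu in [set nu | (0 < nu)%N]) E_weight (Phi nu).

(* Real-valued [sup]: meaningful when the set is bounded above, which holds
   for [g] continuous with [g y / y] tending to infinity. *)
Definition young (R : realType) (g : R -> R) (x : R) : R :=
  sup [set x * y - g y | y in [set y | 0 <= y]].

Definition psi (R : realType) (Phi : nat -> R -> R) (nu : nat) (x : R) : R :=
  Phi nu (expR x).

Definition psi_star (R : realType) (Phi : nat -> R -> R) (nu : nat) : R -> R :=
  young (psi Phi nu).

Definition partial_deriv (R : realType) (n : nat) (i : 'I_n)
    (u : 'rV[R]_n -> R) : 'rV[R]_n -> R :=
  fun x => 'D_(delta_mx 0 i) u x.

(* All iterated partial derivatives, in any order, exist and are continuous. *)
Definition smooth_real (R : realType) (n : nat) (u : 'rV[R]_n -> R) : Prop :=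
  forall s : seq 'I_n, let v := foldr (@partial_deriv R n) u s in
    continuous v /\
    forall (i : 'I_n) (x : 'rV[R]_n), derivable v x (delta_mx 0 i).

(* [R[i]] is not a normed module over [R] in the library, so real
   differentiability of complex-valued functions is taken on the real and
   imaginary parts. *)
Definition smooth (R : realType) (n : nat) (f : 'rV[R]_n -> R[i]) : Prop :=
  smooth_real (fun x => complex.Re (f x)) /\
  smooth_real (fun x => complex.Im (f x)).

Definition mabs (n : nat) (alpha : {ffun 'I_n -> nat}) : nat :=
  (\sum_(i < n) alpha i)%N.

Definition mfact (n : nat) (alpha : {ffun 'I_n -> nat}) : nat :=
  (\prod_(i < n) (alpha i)`!)%N.

Definition mderiv_real (R : realType) (n : nat) (alpha : {ffun 'I_n -> nat})
    (u : 'rV[R]_n -> R) : 'rV[R]_n -> R :=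
  foldr (fun (i : 'I_n) v => iter (alpha i) (partial_deriv i) v) u (enum 'I_n).

Definition mderiv (R : realType) (n : nat) (alpha : {ffun 'I_n -> nat})
    (f : 'rV[R]_n -> R[i]) : 'rV[R]_n -> R[i] :=
  fun x => mderiv_real alpha (fun y => complex.Re (f y)) x
           +i* mderiv_real alpha (fun y => complex.Im (f y)) x.

Definition calE_m (R : realType) (n : nat) (w : R -> R) (m : nat) :
    set ('rV[R]_n -> R[i]) :=
  [set f | smooth f /\
    (ereal_sup [set ((1 + enorm x) ^+ m * Normc.normc (mderiv alpha f x)
                 / ((mfact alpha)%:R * expR (- w (mabs alpha)%:R)))%:E
               | x in [set: 'rV[R]_n] & alpha in [set: {ffun 'I_n -> nat}]]
     < +oo)%E].

Definition calE_weight (R : realType) (n : nat) (w : R -> R) :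
    set ('rV[R]_n -> R[i]) :=
  \bigcap_m calE_m w m.

Definition calE_family (R : realType) (n : nat) (W : nat -> R -> R) :
    set ('rV[R]_n -> R[i]) :=
  \bigcup_(nu in [set nu | (0 < nu)%N]) calE_weight (W nu).

(* Main.v *)
(* For x real, the Taylor series F_x of f at x converges on C^n: the coefficient
   bounds give |D^a f(x)| / a! <= C e^(phi_nu r) r^(-|a|) for every r >= 1. Each F_x is
   entire and extends f, and an entire function is determined by its values on
   R^n, so all the F_x are one function F. Evaluating F(x + iy) = F_x(x + iy) with
   r = max(1, sigma |y|) and summing a geometric series of ratio 1 / sigma gives
   (1 + |x|)^k |F(x + iy)| <= C e^(phi_nu r); (i4) bounds phi_nu r by phi_(nu+1)(|y|),
   and (i2) absorbs the factor (1 + |y|)^k into phi_(nu+2).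

   Uniqueness reduces to a complex differentiable h on C that vanishes on R.
   Goursat's bisection argument yields a second primitive G of h with
   G = 0 on R; then |G exp(-L (z - iT)^2)|^2 is subharmonic, hence bounded on the
   rectangle |x| <= T, 0 <= y <= T uniformly in L >= 0 by its boundary values,
   because Re(-(z - iT)^2) <= 0 on the other three sides. Letting L tend to
   infinity, G = 0 wherever that real part is positive, and any point of the upper
   half plane is such a point for large T. *)
Require Import Defs.
From HB Require Import structures.
From mathcomp Require Import all_boot all_order all_algebra.
From mathcomp Require Import all_classical all_reals all_analysis.
From mathcomp Require Import complex.
From mathcomp Require Import ring lra.
Set Implicit Arguments.
Unset Strict Implicit.
Unset Printing Implicit Defensive.
Import Order.TTheory GRing.Theory Num.Theory.
Import numFieldNormedType.Exports.
Local Open Scope classical_set_scope.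
Local Open Scope ring_scope.
Local Open Scope complex_scope.

(** * Closed forms and Goursat *)

(** The decay of $f$ in $|x|$ is known only for its derivatives at $x$ itself, so a single expansion
    about the origin would extend $f$ but show no decay in the real part. The growth estimate
    therefore needs a different centre for each $z$, and uniqueness becomes an ingredient of that
    estimate rather than a separate claim.

    The obstacle to uniqueness is that [entire] means pointwise complex differentiability: the
    derivative of $h$ is not known to be continuous, let alone differentiable. Integrating instead
    of differentiating avoids this. Each primitive gains one derivative, vanishing on the real axis
    survives when the base point lies there, and $h$ is recovered at the end by differentiating an
    identically zero function. Two primitives provide exactly the second derivatives of a modulus
    squared that a maximum principle requires.

    Multi-indices range over cubes rather than over $|a|\le N$. The geometric majorant then factors
    into $n$ one-variable sums, and Taylor's formula can be applied one coordinate at a time. *)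

Lemma is_derive_continuous (R : realType) (f : R -> R) (x d : R) :
  is_derive x 1 f d -> {for x, continuous f}.
Proof.
by move=> [fx _]; apply: differentiable_continuous; exact/derivable1_diffP.
Qed.

Lemma mean_value_bound (R : realType) (f df : R -> R) (k e a b : R) :
  (forall x : R, is_derive x 1 f (df x)) ->
  (forall x, Num.min a b <= x <= Num.max a b -> `|df x - k| <= e) ->
  `|f b - f a - k * (b - a)| <= e * `|b - a|.
Proof.
move=> fE.
wlog ab : a b / a <= b => [H he|].
  case/orP: (le_total a b) => [ab|ba]; first exact: H.
  have -> : f b - f a - k * (b - a) = - (f a - f b - k * (a - b)) by ring.
  rewrite normrN (distrC b); apply: (H b a ba) => x.
  by rewrite minC maxC; exact: he.
rewrite (min_idPl ab) (max_idPr ab) => he.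
have [c cab ->] := @MVT_segment R f df a b ab (fun x _ => fE x)
  (continuous_subspaceT (fun x => is_derive_continuous (fE x))).
rewrite -mulrBl normrM ler_wpM2r//; apply: he.
by move: cab; rewrite in_itv.
Qed.

Lemma continuous_primitive (R : realType) (g : R -> R) : continuous g ->
  exists G : R -> R, forall x : R, is_derive x 1 G (g x).
Proof.
move=> gc.
pose mu := @lebesgue_measure R.
have gi a b : mu.-integrable `[a, b] (EFin \o g).
  apply: continuous_compact_integrable; first exact: segment_compact.
  exact: continuous_subspaceT.
(* The fundamental theorem is applied on a bounded interval whose left end [- M] must lie below [t];
   no single [M] serves all [t]. *)
pose A (M t : R) := (\int[mu]_(s in `[- M, t]) g s)%R.
have AE (M t : R) : - M < t -> is_derive t 1 (A M) (g t).
  move=> Mt.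
  have t1 : t < t + 1 by rewrite ltrDl.
  have [||H1 H2] := @continuous_FTC1 R g (BLeft (- M)) t _ t1 (gi _ _).
  - by rewrite lte_fin.
  - exact: gc.
  - apply: DeriveDef; first exact: H1.
    by rewrite -derive1E; exact: H2.
have AA (M t : R) : `|t| < M -> A (`|t| + 1) t - A (`|t| + 1) 0 = A M t - A M 0.
  have Asplit (a b c : R) : 0 <= a -> a <= b -> - a <= c ->
      A b c = A b (- a) + A a c.
    move=> a0 ab ac; apply/eqP; rewrite addrC -subr_eq; apply/eqP.
    rewrite /A Rintegral_itvB ?bnd_simp//; last by rewrite lerN2.
    by rewrite Rintegral_itv_obnd_cbnd//; apply: integrableS (gi (- a) c) => //;
      apply: subset_itvr; rewrite bnd_simp.
  move=> tM; have [t0 tN] : 0 <= `|t| /\ - `|t| <= t.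
    by split=> //; rewrite lerNl ler_normr lexx orbT.
  have t1 : `|t| <= `|t| + 1 by rewrite lerDl.
  have N0 : - `|t| <= 0 by rewrite oppr_le0.
  rewrite (Asplit _ _ _ t0 t1 tN) (Asplit _ _ _ t0 t1 N0).
  rewrite (Asplit _ _ _ t0 (ltW tM) tN) (Asplit _ _ _ t0 (ltW tM) N0); ring.
clearbody A.
(* By [AA] any [M] above [|t|] gives the same value, so near [x] this function agrees with the one
   built from the fixed [M] equal to [|x| + 1]. *)
exists (fun t => A (`|t| + 1) t - A (`|t| + 1) 0) => x.
have d1 : is_derive x 1 (fun t => A (`|x| + 1) t - A (`|x| + 1) 0) (g x).
  have d2 : is_derive x 1 (A (`|x| + 1)) (g x).
    apply: AE; rewrite ltrNl (@le_lt_trans _ _ `|x|) ?ltrDl//.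
    by rewrite ler_normr lexx orbT.
  by apply: is_derive_eq; rewrite subr0.
apply: near_eq_is_derive d1.
apply/nbhs_normP; exists 1; first exact: ltr01.
move=> t /= xt; rewrite (AA (`|x| + 1))//.
rewrite addrC -ltrBlDr; apply: le_lt_trans xt.
by rewrite distrC; exact: lerB_dist.
Qed.

(** Differentiability at one point with gradient [(a, b)], asking nothing of the gradient at nearby
    points: the generality of Goursat's argument. *)
Definition frechet2 (R : realType) (P : R -> R -> R) (x0 y0 a b : R) : Prop :=
  forall e : R, 0 < e -> exists2 d : R, 0 < d &
    forall x y : R, `|x - x0| < d -> `|y - y0| < d ->
      `|P x y - P x0 y0 - (a * (x - x0) + b * (y - y0))|
        <= e * (`|x - x0| + `|y - y0|).

Lemma frechet2_continuous (R : realType) (P : R -> R -> R) (x0 y0 a b : R) :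
  frechet2 P x0 y0 a b -> forall e : R, 0 < e -> exists2 d : R, 0 < d &
    forall x y : R, `|x - x0| < d -> `|y - y0| < d -> `|P x y - P x0 y0| < e.
Proof.
move=> dP e e0; have [d d0 dPd] := dP 1 ltr01.
pose k := `|a| + `|b| + 2.
have k0 : 0 < k by rewrite /k -addrA ltr_wpDl// ltr_wpDl.
exists (Num.min d (e / (k + k))); first by rewrite lt_min d0 divr_gt0// addr_gt0.
move=> x y; rewrite !lt_min => /andP[xd xe] /andP[yd ye].
have := dPd x y xd yd; rewrite mul1r.
set u := P x y - _ => h.
have kk : 0 < k + k by exact: addr_gt0.
move: xe ye; rewrite !(ltr_pdivlMr _ _ kk) => xe ye.
have hx := normr_ge0 (x - x0); have hy := normr_ge0 (y - y0).
have : `|a * (x - x0) + b * (y - y0)| <= `|a| * `|x - x0| + `|b| * `|y - y0|.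
  by rewrite -!normrM; exact: ler_normD.
have : `|u| <= `|u - (a * (x - x0) + b * (y - y0))|
             + `|a * (x - x0) + b * (y - y0)|.
  by apply: le_trans (ler_normD _ _); rewrite subrK.
have := mulr_ge0 (normr_ge0 a) hy; have := mulr_ge0 (normr_ge0 b) hx.
move: xe ye; rewrite /k; lra.
Qed.

Lemma frechet2_continuous1 (R : realType) (P : R -> R -> R) :
  (forall x y, exists a b, frechet2 P x y a b) ->
  (forall y, continuous (P ^~ y)) /\ (forall x, continuous (P x)).
Proof.
move=> dP; split=> [y x|x y]; have [a [b /frechet2_continuous h]] := dP x y;
  apply/cvgrPdist_lt => e /h[d d0 hd]; apply/nbhs_normP; exists d => //= t xt.
- by rewrite distrC; apply: hd; rewrite ?subrr ?normr0// distrC.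
- by rewrite distrC; apply: hd; rewrite ?subrr ?normr0// distrC.
Qed.

Lemma ltr_half_expn (R : realType) (x d : R) : 0 < d ->
  exists n : nat, x / 2 ^+ n < d.
Proof.
move=> d0; exists (Num.truncn (x / d)).+1.
rewrite ltr_pdivrMr ?exprn_gt0// mulrC -ltr_pdivrMr//.
apply: (lt_le_trans (truncnS_gt _)).
by rewrite -natrX ler_nat ltnW// ltn_expl.
Qed.

(** The shared coefficient [b] in [dPQ] says that [P dx + Q dy] is closed. [AX] and [AY] turn its
    integrals along horizontal and vertical edges into differences. *)
Section Goursat.
Variables (R : realType) (P Q : R -> R -> R).
Hypothesis dPQ : forall x y, exists a b c,
  frechet2 P x y a b /\ frechet2 Q x y b c.
Variables (AX AY : R -> R -> R).
Hypothesis AXE : forall x y : R, is_derive x 1 (AX y) (P x y).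
Hypothesis AYE : forall x y : R, is_derive y 1 (AY x) (Q x y).

(* The integral of [P dx + Q dy] along the boundary of [a, a + w] x [c, c + h]. *)
Let omega (a c w h : R) : R :=
  (AX c (a + w) - AX c a) - (AX (c + h) (a + w) - AX (c + h) a)
  + (AY (a + w) (c + h) - AY (a + w) c) - (AY a (c + h) - AY a c).

(** For the affine approximations of [P] and [Q] at [(x0, y0)] the integral is exactly zero:
    opposite edges contribute [- k * h * w] and [k * w * h]. The factor 2 arises because each pair
    of opposite edges carries two approximation errors. *)
Let omega_small (x0 y0 e : R) : 0 < e -> exists2 d : R, 0 < d &
  forall a c w h, 0 <= w -> 0 <= h -> w < d -> h < d ->
    a <= x0 <= a + w -> c <= y0 <= c + h ->
    `|omega a c w h| <= e * 2 * (w + h) ^+ 2.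
Proof.
move=> e0; have [k1 [k [k2 [dP dQ]]]] := dPQ x0 y0.
have [d1 d10 h1] := dP e e0; have [d2 d20 h2] := dQ e e0.
exists (Num.min d1 d2); first by rewrite lt_min d10.
move=> a c w h w0 h0; rewrite !lt_min => /andP[w1 w2] /andP[hd1 hd2].
move=> /andP[ax xa] /andP[cy yc].
have near_x t : a <= t <= a + w -> `|t - x0| <= w.
  by move=> /andP[? ?]; rewrite ler_norml; apply/andP; split; lra.
have near_y t : c <= t <= c + h -> `|t - y0| <= h.
  by move=> /andP[? ?]; rewrite ler_norml; apply/andP; split; lra.
have aa : a <= a <= a + w by rewrite lexx lerDl.
have ab : a <= a + w <= a + w by rewrite lexx lerDl w0.
have ca : c <= c <= c + h by rewrite lexx lerDl.
have cb : c <= c + h <= c + h by rewrite lexx lerDl h0.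
have H1 : `|(AX c (a + w) - AX (c + h) (a + w)) - (AX c a - AX (c + h) a)
            - (k * (- h)) * (a + w - a)| <= e * 2 * (w + h) * `|a + w - a|.
  apply: (@mean_value_bound _ (fun t => AX c t - AX (c + h) t)
            (fun t => P t c - P t (c + h))) => t.
  rewrite (min_idPl _) ?lerDl// (max_idPr _) ?lerDl// => tI.
  have tw := near_x _ tI.
  have := h1 t c (le_lt_trans tw w1) (le_lt_trans (near_y _ ca) hd1).
  have := h1 t (c + h) (le_lt_trans tw w1) (le_lt_trans (near_y _ cb) hd1).
  have := near_y _ ca; have := near_y _ cb.
  move: tw; set p := `|t - x0|; set q1 := `|c + h - y0|; set q2 := `|c - y0|.
  move=> pw q1h q2h A1 A2.
  have B1 : e * (p + q1) <= e * (w + h) by rewrite ler_pM2l// lerD.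
  have B2 : e * (p + q2) <= e * (w + h) by rewrite ler_pM2l// lerD.
  move: (le_trans A1 B1) (le_trans A2 B2); rewrite !ler_norml.
  by move=> /andP[? ?] /andP[? ?]; apply/andP; split; lra.
have H2 : `|(AY (a + w) (c + h) - AY a (c + h)) - (AY (a + w) c - AY a c)
            - (k * w) * (c + h - c)| <= e * 2 * (w + h) * `|c + h - c|.
  apply: (@mean_value_bound _ (fun t => AY (a + w) t - AY a t)
            (fun t => Q (a + w) t - Q a t)) => t.
  rewrite (min_idPl _) ?lerDl// (max_idPr _) ?lerDl// => tI.
  have tw := near_y _ tI.
  have := h2 a t (le_lt_trans (near_x _ aa) w2) (le_lt_trans tw hd2).
  have := h2 (a + w) t (le_lt_trans (near_x _ ab) w2) (le_lt_trans tw hd2).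
  have := near_x _ aa; have := near_x _ ab.
  move: tw; set p := `|t - y0|; set q1 := `|a + w - x0|; set q2 := `|a - x0|.
  move=> pw q1h q2h A1 A2.
  have B1 : e * (q1 + p) <= e * (w + h) by rewrite ler_pM2l// lerD.
  have B2 : e * (q2 + p) <= e * (w + h) by rewrite ler_pM2l// lerD.
  move: (le_trans A1 B1) (le_trans A2 B2); rewrite !ler_norml.
  by move=> /andP[? ?] /andP[? ?]; apply/andP; split; lra.
have wE : a + w - a = w by ring.
have hE : c + h - c = h by ring.
move: H1 H2; rewrite wE hE (ger0_norm w0) (ger0_norm h0).
move=> H1 H2; have := le_trans (ler_normD _ _) (lerD H1 H2).
rewrite [X in `|X| <= _](_ : _ = omega a c w h); last by rewrite /omega; ring.
by rewrite [leRHS](_ : _ = e * 2 * (w + h) ^+ 2)//; ring.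
Qed.

(** The integrals over the four quarters add up to the whole, since inner edges cancel; the quarters
    cannot all fall below a fourth of it. *)
Let omega_bisect (a c w h : R) : 0 <= w -> 0 <= h -> exists p : R * R,
  [/\ a <= p.1 <= a + w / 2, c <= p.2 <= c + h / 2 &
      `|omega a c w h| <= 4 * `|omega p.1 p.2 (w / 2) (h / 2)| ].
Proof.
move=> w0 h0.
set w' := w / 2; set h' := h / 2.
have w'0 : 0 <= w' by rewrite divr_ge0.
have h'0 : 0 <= h' by rewrite divr_ge0.
have E : omega a c w h = omega a c w' h' + omega (a + w') c w' h'
                       + omega a (c + h') w' h' + omega (a + w') (c + h') w' h'.
  have -> : w = w' + w' by rewrite -splitr.
  have -> : h = h' + h' by rewrite -splitr.
  by rewrite /omega !addrA; ring.
apply: contrapT => /forallNP H.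
have {}H p1 p2 : a <= p1 <= a + w' -> c <= p2 <= c + h' ->
    4 * `|omega p1 p2 w' h'| < `|omega a c w h|.
  by move=> h1 h2; rewrite ltNge; apply/negP => h3; apply: (H (p1, p2)).
have aa : a <= a <= a + w' by rewrite lexx lerDl.
have ab : a <= a + w' <= a + w' by rewrite lexx lerDl w'0.
have ca : c <= c <= c + h' by rewrite lexx lerDl.
have cb : c <= c + h' <= c + h' by rewrite lexx lerDl h'0.
have := H _ _ aa ca; have := H _ _ aa cb; have := H _ _ ab ca.
have := H _ _ ab cb.
have : `|omega a c w h| <= `|omega a c w' h'| + `|omega (a + w') c w' h'|
    + `|omega a (c + h') w' h'| + `|omega (a + w') (c + h') w' h'|.
  rewrite E; apply: le_trans (ler_normD _ _) _; rewrite lerD2r.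
  by apply: le_trans (ler_normD _ _) _; rewrite lerD2r ler_normD.
lra.
Qed.

Let omega_rect0 (a c w h : R) : 0 <= w -> 0 <= h -> omega a c w h = 0.
Proof.
move=> w0 h0.
have wn n : 0 <= w / 2 ^+ n by rewrite divr_ge0// exprn_ge0.
have hn n : 0 <= h / 2 ^+ n by rewrite divr_ge0// exprn_ge0.
(* The quarter is selected for every scale and corner at once, so that the corners [p n] can be
   defined by recursion. *)
have /choice[F HF] : forall np : nat * (R * R), exists p : R * R,
  [/\ np.2.1 <= p.1 <= np.2.1 + w / 2 ^+ np.1 / 2,
      np.2.2 <= p.2 <= np.2.2 + h / 2 ^+ np.1 / 2 &
      `|omega np.2.1 np.2.2 (w / 2 ^+ np.1) (h / 2 ^+ np.1)|
        <= 4 * `|omega p.1 p.2 (w / 2 ^+ np.1 / 2) (h / 2 ^+ np.1 / 2)| ].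
  by move=> [n p]; exact: omega_bisect.
pose p := fix p n := if n is m.+1 then F (m, p m) else (a, c).
have half (x : R) n : x / 2 ^+ n / 2 = x / 2 ^+ n.+1.
  by rewrite exprSr invfM mulrA.
have pS n : [/\ (p n).1 <= (p n.+1).1 <= (p n).1 + w / 2 ^+ n.+1,
      (p n).2 <= (p n.+1).2 <= (p n).2 + h / 2 ^+ n.+1 &
      `|omega (p n).1 (p n).2 (w / 2 ^+ n) (h / 2 ^+ n)|
        <= 4 * `|omega (p n.+1).1 (p n.+1).2 (w / 2 ^+ n.+1) (h / 2 ^+ n.+1)| ].
  by have := HF (n, p n); rewrite /= !half.
have pE n : `|omega a c w h|
    <= 4 ^+ n * `|omega (p n).1 (p n).2 (w / 2 ^+ n) (h / 2 ^+ n)|.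
  elim: n => [|n IH]; first by rewrite !expr0 !divr1 mul1r.
  apply: (le_trans IH); rewrite exprSr -mulrA ler_pM2l ?exprn_gt0//.
  by have [] := pS n.
have limit (u : nat -> R) (l : R) : 0 <= l ->
    (forall n, u n <= u n.+1 <= u n + l / 2 ^+ n.+1) ->
    exists x, forall n, u n <= x <= u n + l / 2 ^+ n.
  move=> l0 Hu.
  have um : {homo u : m n / (m <= n)%N >-> m <= n}.
    by apply/nondecreasing_seqP => n; have /andP[] := Hu n.
  have vm : {homo (fun n => u n + l / 2 ^+ n) : m n / (m <= n)%N >-> n <= m}.
    apply/nonincreasing_seqP => n; have /andP[_] := Hu n.
    by rewrite -half; set t := l / 2 ^+ n; lra.
  have uv m n : u m <= u n + l / 2 ^+ n.
    apply: (@le_trans _ _ (u (maxn m n))); first by apply: um; rewrite leq_maxl.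
    apply: (@le_trans _ _ (u (maxn m n) + l / 2 ^+ maxn m n)).
      by rewrite lerDl divr_ge0// exprn_ge0.
    by apply: (vm n (maxn m n)); rewrite leq_maxr.
  exists (sup (range u)) => n; apply/andP; split.
    apply: ub_le_sup; last by exists n.
    by exists (u 0%N + l / 2 ^+ 0) => _ [m _ <-].
  by apply: ge_sup; [exists (u 0%N); exists 0%N|move=> _ [m _ <-]].
have [x0 hx0] := limit (fun n => (p n).1) w w0 (fun n => let: And3 h _ _ := pS n in h).
have [y0 hy0] := limit (fun n => (p n).2) h h0 (fun n => let: And3 _ h _ := pS n in h).
have small e : 0 < e -> `|omega a c w h| <= e * 2 * (w + h) ^+ 2.
  move=> e0; have [d d0 Hd] := omega_small x0 y0 e0.
  have [n hnd] := ltr_half_expn (w + h) d0.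
  apply: (le_trans (pE n)).
  have wd : w / 2 ^+ n < d.
    by apply: le_lt_trans hnd; rewrite ler_pM2r ?invr_gt0 ?exprn_gt0// lerDl.
  have hd : h / 2 ^+ n < d.
    by apply: le_lt_trans hnd; rewrite ler_pM2r ?invr_gt0 ?exprn_gt0// lerDr.
  have := Hd _ _ _ _ (wn n) (hn n) wd hd (hx0 n) (hy0 n).
  (* The factor $4^n$ lost by bisection cancels against the squared scale $(2^{-n})^2$, leaving a
     bound proportional to [e]. *)
  rewrite -mulrDl exprMn mulrA exprVn -exprM mulnC exprM.
  rewrite (_ : 2 ^+ 2 = 4 :> R); last by ring.
  by rewrite ler_pdivlMr ?exprn_gt0// mulrC.
apply/eqP; rewrite -normr_eq0 eq_le normr_ge0 andbT; apply/ler_addgt0Pl => e e0.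
rewrite addr0.
pose K := 2 * (w + h) ^+ 2 + 1.
have K0 : 0 < K by rewrite /K ltr_wpDl// mulr_ge0// exprn_ge0// addr_ge0.
apply: le_trans (small (e / K) (divr_gt0 e0 K0)) _.
by rewrite -mulrA mulrAC ler_pdivrMr// ler_pM2l// /K lerDl.
Qed.

Lemma Goursat_rectangle (x y : R) :
  (AX 0 x - AX 0 0) + (AY x y - AY x 0) = (AY 0 y - AY 0 0) + (AX y x - AX y 0).
Proof.
have full a c w h : omega a c w h = 0.
  wlog w0 : a w / 0 <= w => [H|].
    (* A negative side reverses the orientation: seen from the opposite corner, the integral only
       changes sign. *)
    have [/H//|w0] := leP 0 w; have := H (a + w) (- w).
    rewrite oppr_ge0 ltW// => /(_ isT); rewrite /omega.
    have -> : a + w - w = a by ring.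
    lra.
  have [h0|h0] := leP 0 h; first exact: omega_rect0.
  have := @omega_rect0 a (c + h) w (- h) w0.
  rewrite oppr_ge0 ltW// => /(_ isT); rewrite /omega.
  have -> : c + h - h = c by ring.
  lra.
by have := full 0 0 x y; rewrite /omega !add0r; lra.
Qed.

End Goursat.

(** [V] integrates along the horizontal axis and then vertically, so its [y]-derivative is
    immediate. Goursat's identity rewrites [V] along the other two edges, where the last leg is
    horizontal, and this yields the [x]-derivative. *)
Lemma closed_form_potential (R : realType) (P Q : R -> R -> R) :
  (forall x y, exists a b c, frechet2 P x y a b /\ frechet2 Q x y b c) ->
  exists V : R -> R -> R,
    (forall x y : R, is_derive x 1 (V ^~ y) (P x y)) /\
    (forall x y : R, is_derive y 1 (V x) (Q x y)).
Proof.
move=> dPQ.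
have [Pc _] : (forall y, continuous (P ^~ y)) /\ (forall x, continuous (P x)).
  apply: frechet2_continuous1 => x y.
  by have [a [b [c [h _]]]] := dPQ x y; exists a, b.
have [_ Qc] : (forall y, continuous (Q ^~ y)) /\ (forall x, continuous (Q x)).
  apply: frechet2_continuous1 => x y.
  by have [a [b [c [_ h]]]] := dPQ x y; exists b, c.
have /choice[AX AXE] : forall y, exists G : R -> R, forall x : R, is_derive x 1 G (P x y).
  by move=> y; exact: continuous_primitive (Pc y).
have /choice[AY AYE] : forall x, exists G : R -> R, forall y : R, is_derive y 1 G (Q x y).
  by move=> x; exact: continuous_primitive (Qc x).
exists (fun x y => (AX 0 x - AX 0 0) + (AY x y - AY x 0)); split=> x y.
  rewrite [X in is_derive _ _ X](_ : _ =
             fun t => AY 0 y - AY 0 0 + (AX y t - AX y 0)); last first.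
    apply/funext => t.
    exact: (Goursat_rectangle dPQ (fun x y => AXE y x) AYE).
  have dX : is_derive x 1 (AX y) (P x y) := AXE y x.
  have d1 := is_deriveD (is_derive_cst (AY 0 y - AY 0 0) x 1)
               (is_deriveB dX (is_derive_cst (AX y 0) x 1)).
  by apply: is_derive_eq d1 _; rewrite subr0 add0r.
have dY : is_derive y 1 (AY x) (Q x y) := AYE x y.
have d1 := is_deriveD (is_derive_cst (AX 0 x - AX 0 0) y 1)
             (is_deriveB dY (is_derive_cst (AY x 0) y 1)).
by apply: is_derive_eq d1 _; rewrite subr0 add0r.
Qed.

(** The partial derivatives are continuous at the point, so the mean value bound applies on each leg
    of the path through [(x0, y)]. This lets a potential serve as coefficient of the next closed
    form. *)
Lemma frechet2_of_partials (R : realType) (V P Q : R -> R -> R) (x0 y0 : R) :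
  (forall x y : R, is_derive x 1 (V ^~ y) (P x y)) ->
  (forall x y : R, is_derive y 1 (V x) (Q x y)) ->
  (exists a b, frechet2 P x0 y0 a b) -> (exists a b, frechet2 Q x0 y0 a b) ->
  frechet2 V x0 y0 (P x0 y0) (Q x0 y0).
Proof.
move=> VP VQ [a [b /frechet2_continuous cP]] [a' [b' /frechet2_continuous cQ]] e e0.
have [d1 d10 hP] := cP e e0; have [d2 d20 hQ] := cQ e e0.
exists (Num.min d1 d2); first by rewrite lt_min d10.
move=> x y; rewrite !lt_min => /andP[x1 x2] /andP[y1 y2].
have between (s t z : R) : Num.min s t <= z <= Num.max s t -> `|z - s| <= `|t - s|.
  have [st|ts] := leP s t => /andP[h1 h2].
    by rewrite !ger0_norm; lra.
  by rewrite !ler0_norm; lra.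
have H1 : `|V x y - V x0 y - P x0 y0 * (x - x0)| <= e * `|x - x0|.
  apply: (@mean_value_bound _ (V ^~ y) (P ^~ y)) => t /between tx.
  by apply/ltW/hP => //; exact: le_lt_trans x1.
have H2 : `|V x0 y - V x0 y0 - Q x0 y0 * (y - y0)| <= e * `|y - y0|.
  apply: (@mean_value_bound _ (V x0) (Q x0)) => t /between ty.
  by apply/ltW/hQ; rewrite ?subrr ?normr0//; exact: le_lt_trans y2.
have := le_trans (ler_normD _ _) (lerD H1 H2).
rewrite [X in `|X| <= _ -> _](_ : _ = V x y - V x0 y0
  - (P x0 y0 * (x - x0) + Q x0 y0 * (y - y0))); last by ring.
by rewrite -mulrDr.
Qed.

Lemma is_derive_expansion (R : realType) (f : R -> R) (x c : R) :
  is_derive x 1 f c -> forall e : R, 0 < e -> exists2 d : R, 0 < d &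
    forall t, `|t - x| < d -> `|f t - f x - c * (t - x)| <= e * `|t - x|.
Proof.
move=> [fx fc] e e0.
have : h^-1 *: (f (h *: 1 + x) - f x) @[h --> 0^'] --> c.
  by rewrite -fc; exact: fx.
move=> /cvgrPdist_lt /(_ e e0).
rewrite near_withinE => /nbhs_normP[d /= d0 hd]; exists d => // t td.
have [->|tx] := eqVneq t x; first by rewrite !subrr mulr0 subr0 normr0 mulr0.
have tx0 : t - x != 0 by rewrite subr_eq0.
have := hd (t - x); rewrite /= sub0r normrN => /(_ td tx0).
rewrite /GRing.scale/= mulr1 subrK distrC => /ltW h.
rewrite (_ : _ - _ = ((t - x)^-1 * (f t - f x) - c) * (t - x)); last first.
  by rewrite mulrBl mulrAC mulVf// mul1r.
by rewrite normrM ler_wpM2r.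
Qed.

(** [g1] vanishes at [t0]; were [c] positive, [g1] would be positive just to the right and [g] would
    rise above its maximum. *)
Lemma second_derivative_max (R : realType) (g g1 : R -> R) (a b t0 c : R) :
  (forall t : R, is_derive t 1 g (g1 t)) -> is_derive t0 1 g1 c ->
  a < t0 < b -> (forall t, a < t < b -> g t <= g t0) -> c <= 0.
Proof.
move=> gE g1E /andP[at0 t0b] gmax; rewrite leNgt; apply/negP => c0.
have ab : a <= b by apply: ltW; exact: lt_trans t0b.
have g0 : g1 t0 = 0.
  have d0 : is_derive t0 1 g 0.
    apply: (derive1_at_max ab) => [t _||t]; rewrite ?in_itv/= ?at0//.
    exact: gmax.
  by have [_ <-] := gE t0; have [_ ->] := d0.
have [d d0 hd] := is_derive_expansion g1E (divr_gt0 c0 (ltr0Sn R 1)).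
pose t1 := t0 + Num.min (d / 2) ((b - t0) / 2).
have m0 : 0 < Num.min (d / 2) ((b - t0) / 2) by rewrite lt_min; lra.
have md : Num.min (d / 2) ((b - t0) / 2) <= d / 2 by rewrite ge_min lexx.
have mb : Num.min (d / 2) ((b - t0) / 2) <= (b - t0) / 2 by rewrite ge_min lexx orbT.
have t01 : t0 < t1 by rewrite ltrDl.
have [s] := @MVT R g g1 t0 t1 t01 (fun x _ => gE x)
  (continuous_subspaceT (fun x => is_derive_continuous (gE x))).
rewrite in_itv/= => /andP[s0 s1].
have : g t1 <= g t0 by apply: gmax; rewrite /t1; lra.
move=> gt gE1.
have : g1 s * (t1 - t0) <= 0 by rewrite -gE1; lra.
have -> : t1 - t0 = Num.min (d / 2) ((b - t0) / 2) by rewrite /t1; ring.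
rewrite pmulr_lle0// leNgt => /negP; apply.
have st0 : `|s - t0| = s - t0 by rewrite ger0_norm; lra.
have sd : s - t0 < d by move: s1; rewrite /t1; lra.
have := hd s; rewrite st0 g0 => /(_ sd).
rewrite ler_norml => /andP[+ _].
have : 0 < c * (s - t0) by rewrite mulr_gt0//; lra.
lra.
Qed.

(** * Uniqueness of entire extensions *)

Lemma frechet2_continuous_pair (R : realType) (P : R -> R -> R) :
  (forall x y, exists a b, frechet2 P x y a b) ->
  continuous (fun p : R * R => P p.1 p.2).
Proof.
move=> dP [x y]; have [a [b /frechet2_continuous h]] := dP x y.
apply/cvgrPdist_lt => e /h[d d0 hd].
exists (ball x d, ball y d); first by split; exact: nbhsx_ballx.
move=> [s t] [/= xs yt]; rewrite distrC; apply: hd; rewrite distrC.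
  by move: xs; rewrite -ball_normE.
by move: yt; rewrite -ball_normE.
Qed.

(** The hypotheses are the Cauchy-Riemann equations of a holomorphic [G1 + i G2] with derivative
    [F1 + i F2] and second derivative [u + i v]. [S] is the squared modulus of [G1 + i G2]. *)
Section maximum_principle.
Variables (R : realType) (u v F1 F2 G1 G2 : R -> R -> R).
Hypotheses (G1x : forall x y : R, is_derive x 1 (G1 ^~ y) (F1 x y))
  (G1y : forall x y : R, is_derive y 1 (G1 x) (- F2 x y))
  (G2x : forall x y : R, is_derive x 1 (G2 ^~ y) (F2 x y))
  (G2y : forall x y : R, is_derive y 1 (G2 x) (F1 x y)).
Hypotheses (F1x : forall x y : R, is_derive x 1 (F1 ^~ y) (u x y))
  (F1y : forall x y : R, is_derive y 1 (F1 x) (- v x y))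
  (F2x : forall x y : R, is_derive x 1 (F2 ^~ y) (v x y))
  (F2y : forall x y : R, is_derive y 1 (F2 x) (u x y)).
Hypotheses (G1c : continuous (fun p : R * R => G1 p.1 p.2))
  (G2c : continuous (fun p : R * R => G2 p.1 p.2)).

Let S (x y : R) : R := G1 x y ^+ 2 + G2 x y ^+ 2.

Variables (T L : R).

(* [q] is the real part of [- L (z - iT)^2]. The term [x ^+ 2] in [W] makes the
   Laplacian positive, which excludes interior maxima. *)
Let q (x y : R) : R := L * ((T - y) ^+ 2 - x ^+ 2).
Let W (x y : R) : R := S x y * expR (q x y) + x ^+ 2.

Let Wx (x y : R) : R := (2 * (G1 x y * F1 x y + G2 x y * F2 x y)
               + S x y * (- 2 * L * x)) * expR (q x y) + 2 * x.
Let Wy (x y : R) : R := (2 * (- G1 x y * F2 x y + G2 x y * F1 x y)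
               + S x y * (- 2 * L * (T - y))) * expR (q x y).
Let Wxx (x y : R) : R :=
  (2 * (F1 x y ^+ 2 + F2 x y ^+ 2 + G1 x y * u x y + G2 x y * v x y)
   + 4 * (G1 x y * F1 x y + G2 x y * F2 x y) * (- 2 * L * x)
   + S x y * ((- 2 * L * x) ^+ 2 - 2 * L)) * expR (q x y) + 2.
Let Wyy (x y : R) : R :=
  (2 * (F1 x y ^+ 2 + F2 x y ^+ 2 - G1 x y * u x y - G2 x y * v x y)
   + 4 * (- G1 x y * F2 x y + G2 x y * F1 x y) * (- 2 * L * (T - y))
   + S x y * ((- 2 * L * (T - y)) ^+ 2 + 2 * L)) * expR (q x y).

Let qx (x y : R) :
  is_derive x 1 (fun t => expR (q t y)) (expR (q x y) * (- 2 * L * x)).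
Proof.
have d : is_derive x 1 (q ^~ y) (- 2 * L * x).
  by apply: is_derive_eq; rewrite /GRing.scale /=; ring.
exact: (@is_derive1_comp R expR (q ^~ y) x _ _ (is_derive_expR _) d).
Qed.

Let qy (x y : R) :
  is_derive y 1 (fun t => expR (q x t)) (expR (q x y) * (- 2 * L * (T - y))).
Proof.
have d : is_derive y 1 (q x) (- 2 * L * (T - y)).
  by apply: is_derive_eq; rewrite /GRing.scale /=; ring.
exact: (@is_derive1_comp R expR (q x) y _ _ (is_derive_expR _) d).
Qed.

Let WxE (x y : R) : is_derive x 1 (W ^~ y) (Wx x y).
Proof.
have ? := G1x x y; have ? := G2x x y; have ? := qx x y.
by apply: is_derive_eq; rewrite /Wx /S /GRing.scale /=; ring.
Qed.

Let WyE (x y : R) : is_derive y 1 (W x) (Wy x y).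
Proof.
have ? := G1y x y; have ? := G2y x y; have ? := qy x y.
by apply: is_derive_eq; rewrite /Wy /S /GRing.scale /=; ring.
Qed.

Let WxxE (x y : R) : is_derive x 1 (Wx ^~ y) (Wxx x y).
Proof.
have ? := G1x x y; have ? := G2x x y; have ? := qx x y.
have ? := F1x x y; have ? := F2x x y.
by apply: is_derive_eq; rewrite /Wxx /S /GRing.scale /=; ring.
Qed.

Let WyyE (x y : R) : is_derive y 1 (Wy x) (Wyy x y).
Proof.
have ? := G1y x y; have ? := G2y x y; have ? := qy x y.
have ? := F1y x y; have ? := F2y x y.
by apply: is_derive_eq; rewrite /Wyy /S /GRing.scale /=; ring.
Qed.

(* [S e^q] is the squared modulus of a holomorphic function, hence
   subharmonic; its Laplacian is a sum of two squares. *)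
Let laplacian_gt0 (x y : R) : 0 < Wxx x y + Wyy x y.
Proof.
rewrite (_ : _ + _ =
  ((2 * F1 x y + G1 x y * (- 2 * L * x) + G2 x y * (- 2 * L * (T - y))) ^+ 2
  + (2 * F2 x y + G2 x y * (- 2 * L * x) - G1 x y * (- 2 * L * (T - y))) ^+ 2)
  * expR (q x y) + 2); last by rewrite /Wxx /Wyy /S; ring.
apply: ltr_wpDl => //.
by apply: mulr_ge0; [apply: addr_ge0; exact: sqr_ge0|exact: expR_ge0].
Qed.

Let W_continuous : continuous (fun p : R * R => W p.1 p.2).
Proof.
have c1 : continuous (fun p : R * R => p.1) by move=> p; exact: cvg_fst.
have c2 : continuous (fun p : R * R => p.2) by move=> p; exact: cvg_snd.
move=> p; apply: cvgD.
  apply: cvgM; first by apply: cvgD; apply: cvgM; (exact: G1c || exact: G2c).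
  apply: continuous_comp; last exact: continuous_expR.
  apply: cvgM; first exact: cvg_cst.
  apply: cvgB; last by apply: cvgM; exact: c1.
  by apply: cvgM; apply: cvgB; (exact: cvg_cst || exact: c2).
by apply: cvgM; exact: c1.
Qed.

Lemma weighted_bound (B : R) : 0 < T -> 0 <= L ->
  (forall x, G1 x 0 = 0 /\ G2 x 0 = 0) ->
  (forall x y, `|x| <= T -> 0 <= y <= T -> S x y <= B) ->
  forall x y, `|x| <= T -> 0 <= y <= T -> W x y <= B + T ^+ 2.
Proof.
move=> T0 L0 G0 SB x y xT yT.
have S0 s t : 0 <= S s t by rewrite /S addr_ge0 ?sqr_ge0.
have B0 : 0 <= B.
  apply: (le_trans (S0 0 0)); apply: SB; first by rewrite normr0 ltW.
  by rewrite lexx ltW.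
pose A : set (R * R) := `[- T, T] `*` `[0, T].
have Ac : compact A by apply: compact_setX; exact: segment_compact.
have A0 : A !=set0.
  by exists (0, 0); split; rewrite /= in_itv/= ?lexx ?oppr_le0 ltW.
have [[x0 y0] /set_mem[/=]] := compact_EVT_max A0 Ac
  (continuous_subspaceT W_continuous).
rewrite !in_itv/= => /andP[x1 x2] /andP[y1 y2] Wmax.
have {}Wmax s t : - T <= s <= T -> 0 <= t <= T -> W s t <= W x0 y0.
  by move=> sT tT; apply: (Wmax (s, t)); apply/mem_set; split; rewrite /= in_itv.
apply: (@le_trans _ _ (W x0 y0)); first by apply: Wmax; rewrite -?ler_norml.
have x0T : `|x0| <= T by rewrite ler_norml x1.
have x0T2 : x0 ^+ 2 <= T ^+ 2.
  by rewrite -(real_normK (num_real x0)) lerXn2r ?nnegrE ?(ltW T0).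
have bd : q x0 y0 <= 0 -> W x0 y0 <= B + T ^+ 2.
  move=> q0; apply: lerD.
    apply: (@le_trans _ _ (S x0 y0)).
      by rewrite ler_piMr// -expR0 ler_expR.
    by apply: SB; rewrite ?y1.
  exact: x0T2.
have sqT : (T - y0) ^+ 2 <= T ^+ 2.
  by rewrite lerXn2r ?nnegrE; lra.
have [xN|xN] := eqVneq x0 (- T).
  by apply: bd; rewrite /q mulr_ge0_le0// xN sqrrN subr_le0.
have [xP|xP] := eqVneq x0 T.
  by apply: bd; rewrite /q mulr_ge0_le0// xP subr_le0.
have [yP|yP] := eqVneq y0 T.
  apply: bd; rewrite /q mulr_ge0_le0// yP subrr expr0n/= sub0r oppr_le0.
  exact: sqr_ge0.
(* On this side [q] may be large, but [S] vanishes and only the term [x0 ^+ 2] of [W] remains. *)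
have [yN|yN] := eqVneq y0 0.
  rewrite /W /S yN; have [-> ->] := G0 x0.
  by rewrite expr0n/= addr0 mul0r add0r ler_wpDl.
have {}x1 : - T < x0 by rewrite lt_neqAle eq_sym xN.
have {}x2 : x0 < T by rewrite lt_neqAle xP.
have {}y1 : 0 < y0 by rewrite lt_neqAle eq_sym yN.
have {}y2 : y0 < T by rewrite lt_neqAle yP.
(* An interior maximum makes each pure second derivative nonpositive, against [laplacian_gt0]. *)
have h1 : Wxx x0 y0 <= 0.
  apply: (second_derivative_max (WxE ^~ y0) (WxxE x0 y0) (a := - T) (b := T)).
    by rewrite x1.
  by move=> t /andP[? ?]; apply: Wmax; rewrite ?ltW//; apply/andP; split; exact: ltW.
have h2 : Wyy x0 y0 <= 0.
  apply: (second_derivative_max (WyE x0) (WyyE x0 y0) (a := 0) (b := T)).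
    by rewrite y1.
  by move=> t /andP[? ?]; apply: Wmax; rewrite ?ltW//; apply/andP; split; exact: ltW.
by have := laplacian_gt0 x0 y0; lra.
Qed.

End maximum_principle.

Lemma frechet2N (R : realType) (P : R -> R -> R) (x y a b : R) :
  frechet2 P x y a b -> frechet2 (fun s t => - P s t) x y (- a) (- b).
Proof.
move=> dP e /dP[d d0 hd]; exists d => // s t sd td.
by rewrite !mulNr -!opprD normrN; exact: hd.
Qed.

(** Along the real axis [V] has derivative [P = 0], so normalising it at the origin makes it vanish
    there. The conclusions reproduce what the construction needs, so it can be iterated. *)
Lemma closed_form_potential0 (R : realType) (P Q : R -> R -> R) :
  (forall x y, exists a b c, frechet2 P x y a b /\ frechet2 Q x y b c) ->
  (forall x, P x 0 = 0) ->
  exists V : R -> R -> R,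
    [/\ forall x y : R, is_derive x 1 (V ^~ y) (P x y),
        forall x y : R, is_derive y 1 (V x) (Q x y),
        forall x, V x 0 = 0 &
        forall x y, frechet2 V x y (P x y) (Q x y)].
Proof.
move=> dPQ P0; have [V [VP VQ]] := closed_form_potential dPQ.
exists (fun x y => V x y - V 0 0).
have VP' (x y : R) : is_derive x 1 (fun t => V t y - V 0 0) (P x y).
  by have d := is_deriveB (VP x y) (is_derive_cst (V 0 0) x 1);
    apply: is_derive_eq d _; rewrite subr0.
have VQ' (x y : R) : is_derive y 1 (fun t => V x t - V 0 0) (Q x y).
  by have d := is_deriveB (VQ x y) (is_derive_cst (V 0 0) y 1);
    apply: is_derive_eq d _; rewrite subr0.
split=> // [x|x y].
  apply/eqP; rewrite subr_eq0; apply/eqP.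
  apply: (@is_derive_0_is_cst _ (V ^~ 0)) => t.
  by apply: is_derive_eq (VP t 0) _.
by apply: (frechet2_of_partials VP' VQ');
  have [a [b [c [h1 h2]]]] := dPQ x y; [exists a, b|exists b, c].
Qed.

Lemma is_derive_cst0 (R : realType) (f : R -> R) (x d : R) :
  is_derive x 1 f d -> (forall t, f t = 0) -> d = 0.
Proof.
move=> [_ <-] f0; have -> : f = cst 0 by apply/funext.
exact: derive_cst.
Qed.

(* [u + iv] has a primitive [F1 + i F2], which in turn has a primitive [G1 + i G2];
   the latter is twice differentiable, as the maximum principle requires. *)
Lemma cauchy_riemann_unique (R : realType) (u v : R -> R -> R) :
  (forall x y, exists a b, frechet2 u x y a (- b) /\ frechet2 v x y b a) ->
  (forall x, u x 0 = 0 /\ v x 0 = 0) ->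
  forall x y, 0 < y -> u x y = 0 /\ v x y = 0.
Proof.
move=> uv uv0.
(* The real and imaginary parts of [(u + iv)(dx + i dy)] are [u dx - v dy] and [v dx + u dy]; the
   Cauchy-Riemann equations make both closed. *)
have [||F1 [F1x F1y F10 F1f]] := @closed_form_potential0 R u (fun x y => - v x y).
- move=> x y; have [a [b [hu hv]]] := uv x y; exists a, (- b), (- a).
  by split=> //; exact: frechet2N.
- by move=> x; have [] := uv0 x.
have [||F2 [F2x F2y F20 F2f]] := @closed_form_potential0 R v u.
- by move=> x y; have [a [b [hu hv]]] := uv x y; exists b, a, (- b).
- by move=> x; have [] := uv0 x.
have [||G1 [G1x G1y G10 G1f]] := @closed_form_potential0 R F1 (fun x y => - F2 x y).
- move=> x y; exists (u x y), (- v x y), (- u x y); split=> //.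
  exact: frechet2N.
- by [].
have [||G2 [G2x G2y G20 G2f]] := @closed_form_potential0 R F2 F1.
- by move=> x y; exists (v x y), (u x y), (- v x y).
- by [].
have G1c : continuous (fun p : R * R => G1 p.1 p.2).
  by apply: frechet2_continuous_pair => x y; exists (F1 x y), (- F2 x y).
have G2c : continuous (fun p : R * R => G2 p.1 p.2).
  by apply: frechet2_continuous_pair => x y; exists (F2 x y), (F1 x y).
have G0 x y : 0 < y -> G1 x y ^+ 2 + G2 x y ^+ 2 = 0.
  move=> y0; pose T := `|x| + y + 1.
  (* This [T] gives [T - y = |x| + 1 > |x|], so the exponent [p] at [(x, y)] is positive. *)
  have T0 : 0 < T by rewrite /T addr_gt0// ltr_wpDl.
  pose A : set (R * R) := `[- T, T] `*` `[0, T].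
  have Ac : compact A by apply: compact_setX; exact: segment_compact.
  have A0 : A !=set0.
    by exists (0, 0); split; rewrite /= in_itv/= ?lexx ?oppr_le0 ltW.
  have Sc : continuous (fun p : R * R => G1 p.1 p.2 ^+ 2 + G2 p.1 p.2 ^+ 2).
    by move=> p; apply: cvgD; apply: cvgM; (exact: G1c || exact: G2c).
  have [[x1 y1] _ Smax] := compact_EVT_max A0 Ac (continuous_subspaceT Sc).
  set B := G1 x1 y1 ^+ 2 + G2 x1 y1 ^+ 2 in Smax.
  have S0 s t : 0 <= G1 s t ^+ 2 + G2 s t ^+ 2 by rewrite addr_ge0 ?sqr_ge0.
  have SB s t : `|s| <= T -> 0 <= t <= T -> G1 s t ^+ 2 + G2 s t ^+ 2 <= B.
    rewrite ler_norml => sT tT; apply: (Smax (s, t)).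
    by apply/mem_set; split; rewrite /= in_itv.
  apply/eqP; rewrite eq_le S0 andbT leNgt; apply/negP => Sgt0.
  set S := (X in 0 < X) in Sgt0.
  pose p := (T - y) ^+ 2 - x ^+ 2.
  have p0 : 0 < p.
    rewrite /p subr_gt0 -(real_normK (num_real x)) ltrXn2r ?nnegrE//;
    by rewrite /T; have := normr_ge0 x; lra.
  (* An explicit [L] replaces the limit: [expR (L * p) >= 1 + L * p] makes the weighted value at
     least [S + B + T ^+ 2], which exceeds the bound. *)
  pose L := (B + T ^+ 2) / (S * p).
  have BT : 0 <= B + T ^+ 2 by apply: addr_ge0; [exact: S0|exact: sqr_ge0].
  have L0 : 0 <= L by rewrite /L divr_ge0// mulr_ge0// ltW.
  have xT : `|x| <= T by rewrite /T; lra.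
  have yT : 0 <= y <= T by rewrite /T; have := normr_ge0 x; lra.
  have := weighted_bound G1x G1y G2x G2y F1x F1y F2x F2y G1c G2c T0 L0
    (fun s => conj (G10 s) (G20 s)) SB xT yT.
  rewrite -/S -/p leNgt => /negP; apply.
  have LS : S * (L * p) = B + T ^+ 2.
    rewrite /L; field; rewrite !gt_eqF//.
  apply: (@lt_le_trans _ _ (S * (1 + L * p))).
    by rewrite mulrDr LS mulr1 ltrDr.
  rewrite -[leLHS]addr0 lerD ?sqr_ge0// ler_pM2l//.
  exact: expR_ge1Dx.
have G12 x y : 0 < y -> G1 x y = 0 /\ G2 x y = 0.
  move=> /(G0 x)/eqP; rewrite paddr_eq0 ?sqr_ge0// !sqrf_eq0.
  by move=> /andP[/eqP-> /eqP->].
(* The horizontal line through [(x, y)] stays in the upper half plane, so differentiating zero along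
   it is enough, here and once more for [u] and [v]. *)
have F12 x y : 0 < y -> F1 x y = 0 /\ F2 x y = 0.
  move=> y0; split.
    by apply: (is_derive_cst0 (G1x x y)) => t; have [] := G12 t y y0.
  by apply: (is_derive_cst0 (G2x x y)) => t; have [] := G12 t y y0.
move=> x y y0; split.
  by apply: (is_derive_cst0 (F1x x y)) => t; have [] := F12 t y y0.
by apply: (is_derive_cst0 (F2x x y)) => t; have [] := F12 t y y0.
Qed.

(** * Restriction of entire functions to complex lines *)

Lemma differentiable_line (K : numFieldType) (n : nat) (F : 'rV[K]_n -> K)
    (z y : 'rV[K]_n) : differentiable F z ->
  exists L : K, forall e : K, 0 < e -> exists2 d : K, 0 < d &
    forall w : K, `|w| < d -> `|F (z + w *: y) - F z - w * L| <= e * `|w|.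
Proof.
move=> /(@diff_derivable _ _ _ _ _ y) Fy; exists ('D_y F z) => e e0.
have : h^-1 *: (F (h *: y + z) - F z) @[h --> 0^'] --> 'D_y F z by exact: Fy.
move=> /cvgrPdist_lt /(_ e e0).
rewrite near_withinE => /nbhs_normP[d /= d0 hd]; exists d => // w wd.
have [->|w0] := eqVneq w 0; first by rewrite scale0r addr0 subrr mul0r subr0 normr0 mulr0.
have := hd w; rewrite /= sub0r normrN => /(_ wd w0).
rewrite /GRing.scale/= distrC (addrC _ z) => /ltW h.
rewrite (_ : _ - _ = (w^-1 * (F (z + w *: y) - F z) - 'D_y F z) * w); last first.
  by rewrite mulrBl mulrAC mulVf// mul1r (mulrC w).
by rewrite normrM ler_wpM2r.
Qed.

Lemma normr_normc (R : realType) (z : R[i]) : `|z| = (Normc.normc z)%:C.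
Proof. by []. Qed.

Lemma normc_ge0 (R : realType) (z : R[i]) : 0 <= Normc.normc z.
Proof. by case: z => a b; exact: sqrtr_ge0. Qed.

Lemma normc_le_sum (R : realType) (a b : R) :
  Normc.normc (a +i* b) <= `|a| + `|b|.
Proof.
rewrite /= -[leRHS]ger0_norm ?addr_ge0// -sqrtr_sqr ler_wsqrtr//.
rewrite sqrrD !real_normK ?num_real// addrAC lerDl.
by rewrite mulrn_wge0// mulr_ge0.
Qed.

Lemma Re_le_normc (R : realType) (z : R[i]) : `|complex.Re z| <= Normc.normc z.
Proof.
by case: z => a b /=; rewrite -sqrtr_sqr ler_wsqrtr// lerDl sqr_ge0.
Qed.

Lemma Im_le_normc (R : realType) (z : R[i]) : `|complex.Im z| <= Normc.normc z.
Proof.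
by case: z => a b /=; rewrite -sqrtr_sqr ler_wsqrtr// lerDr sqr_ge0.
Qed.

Lemma entireB (K : numFieldType) (n : nat) (F G : 'rV[K]_n -> K) :
  entire F -> entire G -> entire (fun z => F z - G z).
Proof. by move=> dF dG z; apply: differentiableB; [exact: dF|exact: dG]. Qed.

(** The two gradients are the rows of the matrix of multiplication by [a + ib], the complex
    derivative along the line. *)
Lemma entire_line (R : realType) (n : nat) (F : 'rV[R[i]]_n -> R[i])
    (z y : 'rV[R[i]]_n) : entire F ->
  let h (s t : R) := F (z + (s +i* t) *: y) in
  forall s t : R, exists a b : R,
    frechet2 (fun s t => complex.Re (h s t)) s t a (- b) /\
    frechet2 (fun s t => complex.Im (h s t)) s t b a.
Proof.
move=> Fe h s0 t0.
have [[a b] hL] := differentiable_line y (Fe (z + (s0 +i* t0) *: y)).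
exists a, b.
have main (e : R) : 0 < e -> exists2 d : R, 0 < d & forall s t : R,
    `|s - s0| < d -> `|t - t0| < d ->
    Normc.normc (h s t - h s0 t0 - ((s - s0) +i* (t - t0)) * (a +i* b))
      <= e * (`|s - s0| + `|t - t0|).
  move=> e0; have e0' : 0 < e%:C by rewrite ltcR.
  have [[d d'] + hd] := hL _ e0'.
  (* A positive element of [R[i]] has zero imaginary part, so the radius is real. *)
  rewrite ltcE /= => /andP[/eqP dd d0]; rewrite dd in hd.
  exists (d / 2); first by rewrite divr_gt0.
  move=> s t sd td; set w := (s - s0) +i* (t - t0).
  have wle : Normc.normc w <= `|s - s0| + `|t - t0| by exact: normc_le_sum.
  have wd : `|w| < d%:C by rewrite normr_normc ltcR; apply: le_lt_trans wle _; lra.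
  have := hd w wd.
  have -> : z + (s0 +i* t0) *: y + w *: y = z + (s +i* t) *: y.
    rewrite -addrA -scalerDl; congr (_ + _ *: _).
    by apply/eqP; rewrite eq_complex /= !subrKC !eqxx.
  rewrite !normr_normc -rmorphM lecR => /le_trans; apply.
  by rewrite ler_pM2l.
split=> e /main[d d0 hd]; exists d => // s t sd td.
  apply: le_trans (hd s t sd td).
  apply: le_trans (Re_le_normc _).
  rewrite le_eqVlt; apply/orP; left; apply/eqP; congr `|_|.
  by case: (h s t) => ? ?; case: (h s0 t0) => ? ? /=; ring.
apply: le_trans (hd s t sd td).
apply: le_trans (Im_le_normc _).
rewrite le_eqVlt; apply/orP; left; apply/eqP; congr `|_|.
by case: (h s t) => ? ?; case: (h s0 t0) => ? ? /=; ring.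
Qed.

(** For [z = x + iy], the complex line [w -> x + w y] maps real [w] into $\mathbb R^n$ and [w = i]
    to [z]. *)
Lemma entire_real_unique (R : realType) (n : nat) (F G : 'rV[R[i]]_n -> R[i]) :
  entire F -> entire G -> (forall x : 'rV[R]_n, F (cembed x) = G (cembed x)) ->
  F = G.
Proof.
move=> Fe Ge FG; apply/funext => z; apply/eqP; rewrite -subr_eq0; apply/eqP.
pose H z := F z - G z; rewrite -/(H z).
pose x : 'rV[R]_n := \row_i complex.Re (z 0 i).
pose y := imvec z.
have H0 s : H (cembed x + (s +i* 0) *: cembed y) = 0.
  rewrite (_ : _ + _ = cembed (x + s *: y)); first by rewrite /H FG subrr.
  by apply/rowP => i; rewrite !mxE; simpc.
have HR s : complex.Re (H (cembed x + (s +i* 0) *: cembed y)) = 0 /\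
    complex.Im (H (cembed x + (s +i* 0) *: cembed y)) = 0 by rewrite H0.
have := cauchy_riemann_unique
  (entire_line (cembed x) (cembed y) (entireB Fe Ge)) HR 0 ltr01.
rewrite (_ : cembed x + (0 +i* 1) *: cembed y = z); last first.
  by apply/rowP => i; rewrite !mxE; case: (z 0 i) => a b; simpc.
by rewrite -/(H z); case: (H z) => a b /= [-> ->].
Qed.

(** * Power series on C^n *)

Lemma normr_coord_le (K : numDomainType) (n : nat) (d : 'rV[K]_n) (j : 'I_n) :
  `|d 0 j| <= `|d|.
Proof.
rewrite [leRHS]mx_normE -[leLHS]nngE num_le.
exact: (le_bigmax _ (fun i : 'I_1 * 'I_n => `|d i.1 i.2|%:nng) (0, j)).
Qed.

Definition linear_form (K : numFieldType) (n : nat) (g : 'I_n -> K)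
  (d : 'rV[K]_n) : K := \sum_j g j * d 0 j.

Section linear_form_linear.
Variables (K : numFieldType) (n : nat) (g : 'I_n -> K).
Fact linear_form_is_linear : linear (linear_form g : 'rV[K]_n -> K^o).
Proof.
move=> a x y; rewrite /linear_form scaler_sumr -big_split/=.
by apply: eq_bigr => j _; rewrite !mxE mulrDr mulrCA.
Qed.
HB.instance Definition _ := GRing.isLinear.Build K 'rV[K]_n K^o _
  (linear_form g) linear_form_is_linear.
End linear_form_linear.

Lemma linear_form_continuous (K : numFieldType) (n : nat) (g : 'I_n -> K) :
  continuous (linear_form g).
Proof.
move=> d; apply: differentiable_continuous.
rewrite (_ : linear_form g = \sum_j (g j *: (fun x : 'rV[K]_n => x 0 j : K^o))).
  by apply: differentiable_sum => j; apply: differentiableZ;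
    exact: differentiable_coord.
by apply/funext => x; rewrite fct_sumE.
Qed.

Lemma differentiable_quadratic (K : numFieldType) (V W : normedModType K)
    (f : V -> W) (df : {linear V -> W}) (x : V) (C : K) : 0 <= C ->
  continuous df ->
  (forall h : V, `|h| <= 1 -> `|f (x + h) - f x - df h| <= C * `|h| ^+ 2) ->
  differentiable f x.
Proof.
move=> C0 dfc fC.
have E : f \o shift x = cst (f x) + df +o_ 0 id.
  apply/eqaddoP => e e0; near=> h.
  rewrite [X in `|X| <= _](_ : _ = f (x + h) - f x - df h); last first.
    by rewrite -addrA -opprD /= (addrC x).
  have h1 : `|h| <= 1 by near: h; apply: nbhs0_le.
  have hC : `|h| <= e / (C + 1).
    by near: h; apply: nbhs0_le; rewrite divr_gt0// ltr_wpDl.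
  apply: (le_trans (fC h h1)).
  rewrite expr2 mulrA ler_wpM2r//.
  rewrite ler_pdivlMr ?ltr_wpDl// in hC.
  by apply: le_trans hC; rewrite mulrC ler_wpM2l// lerDl.
have dE := diff_unique dfc E.
by apply/diff_locallyP; rewrite dE; split.
Unshelve. all: by end_near. Qed.

Lemma differentiable_of_quadratic (K : numFieldType) (n : nat)
    (F : 'rV[K]_n -> K) (z : 'rV[K]_n) (g : 'I_n -> K) (C : K) : 0 <= C ->
  (forall (d : 'rV[K]_n) (s : K), 0 <= s <= 1 -> (forall j, `|d 0 j| <= s) ->
    `|F (z + d) - F z - linear_form g d| <= C * s ^+ 2) ->
  differentiable F z.
Proof.
move=> C0 FC.
apply: (@differentiable_quadratic K _ _ F (linear_form g : {linear 'rV[K]_n -> K^o}) z C C0).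
  exact: linear_form_continuous.
move=> h h1; apply: FC; first by rewrite normr_ge0.
by move=> j; exact: normr_coord_le.
Qed.

(** * Sums over cubes of multi-indices *)

Definition cube_index (n N : nat) (a : {ffun 'I_n -> 'I_N.+1}) :
  {ffun 'I_n -> nat} := [ffun i => nat_of_ord (a i)].

(* Multi-indices with all entries at most [N] (not at most [N.-1]). *)
Definition cube_sum (V : nmodType) (n N : nat) (F : {ffun 'I_n -> nat} -> V) : V :=
  \sum_(a : {ffun 'I_n -> 'I_N.+1}) F (cube_index a).

(** Cubes of different sizes have different index types; over the larger type the two sums can be
    subtracted. *)
Lemma cube_sum_widen (V : nmodType) (n N M : nat) (F : {ffun 'I_n -> nat} -> V) :
  (N <= M)%N -> cube_sum N F =
  \sum_(a : {ffun 'I_n -> 'I_M.+1} | [forall i, (a i <= N)%N]) F (cube_index a).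
Proof.
move=> NM; rewrite /cube_sum.
pose h (b : {ffun 'I_n -> 'I_N.+1}) : {ffun 'I_n -> 'I_M.+1} :=
  [ffun i => inord (b i)].
pose h' (a : {ffun 'I_n -> 'I_M.+1}) : {ffun 'I_n -> 'I_N.+1} :=
  [ffun i => inord (a i)].
have hE b i : h b i = b i :> nat.
  by rewrite ffunE inordK// ltnS (leq_trans _ NM)// -ltnS.
rewrite (reindex_onto h h') => [|a /forallP aN]; last first.
  by apply/ffunP => i; rewrite !ffunE inordK ?ltnS// inord_val.
apply: eq_big => [b|b _]; last first.
  by congr F; apply/ffunP => i; rewrite !ffunE inordK// ltnS (leq_trans _ NM)// -ltnS.
symmetry; apply/andP; split.
  by apply/forallP => i; rewrite hE -ltnS.
by apply/eqP/ffunP => i; rewrite ffunE hE inord_val.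
Qed.

Lemma cube_sum_prod (K : comPzRingType) (n N : nat) (g : 'I_n -> nat -> K) :
  cube_sum N (fun a => \prod_i g i (a i)) = \prod_i \sum_(k < N.+1) g i k.
Proof.
rewrite bigA_distr_bigA; apply: eq_bigr => a _.
by apply: eq_bigr => i _; rewrite ffunE.
Qed.

Lemma normc_sum (R : realType) (I : finType) (P : pred I) (F : I -> R[i])
    (G : I -> R) : (forall i, P i -> Normc.normc (F i) <= G i) ->
  Normc.normc (\sum_(i | P i) F i) <= \sum_(i | P i) G i.
Proof.
move=> FG; apply: (big_ind2 (fun x y => Normc.normc x <= y)) => //.
  by rewrite Normc.normc0.
by move=> x1 y1 x2 y2 h1 h2; apply: le_trans (le_normcD _ _) _; exact: lerD.
Qed.

Lemma cube_sum_cauchy (R : realType) (n N M : nat)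
    (F : {ffun 'I_n -> nat} -> R[i]) (G : {ffun 'I_n -> nat} -> R) :
  (N <= M)%N -> (forall a, Normc.normc (F a) <= G a) ->
  Normc.normc (cube_sum M F - cube_sum N F) <= cube_sum M G - cube_sum N G.
Proof.
move=> NM FG; rewrite !(cube_sum_widen _ NM) /cube_sum.
pose P (a : {ffun 'I_n -> 'I_M.+1}) := [forall i, (a i <= N)%N].
rewrite [in leLHS](bigID P) [in leRHS](bigID P) /= !(addrC (\sum_(_ | P _) _)) !addrK.
by apply: normc_sum => a _; exact: FG.
Qed.

(** The sum factors into [n] equal finite geometric sums; the bound is uniform in [N]. *)
Lemma cube_sum_geometric (R : realType) (n N : nat) (q : R) : 0 <= q < 1 ->
  cube_sum N (fun a : {ffun 'I_n -> nat} => q ^+ mabs a) <= ((1 - q)^-1) ^+ n.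
Proof.
move=> /andP[q0 q1].
under [cube_sum _ _]eq_bigr do rewrite /mabs -prodrXr.
rewrite -/(cube_sum N (fun a : {ffun 'I_n -> nat} => \prod_i q ^+ a i)).
rewrite (cube_sum_prod N (fun _ k => q ^+ k)) prodr_const card_ord.
have q1' : 0 < 1 - q by rewrite subr_gt0.
apply: lerXn2r; rewrite ?nnegrE.
- by apply: sumr_ge0 => k _; exact: exprn_ge0.
- by rewrite invr_ge0 ltW.
rewrite -[leRHS]mul1r ler_pdivlMr// mulrC.
have := subrX1 q N.+1; have := exprn_ge0 N.+1 q0.
by move=> h1 h2; rewrite -opprB mulNr -h2; lra.
Qed.

(** * Limits of complex sequences, with real-valued modulus *)

Definition ccvg (R : realType) (w : nat -> R[i]) (l : R[i]) : Prop :=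
  forall e : R, 0 < e -> \forall N \near \oo, Normc.normc (w N - l) <= e.

Lemma ccvgD (R : realType) (w w' : nat -> R[i]) (l l' : R[i]) :
  ccvg w l -> ccvg w' l' -> ccvg (fun N => w N + w' N) (l + l').
Proof.
move=> wl wl' e e0; have e2 : 0 < e / 2 by rewrite divr_gt0.
near=> N; rewrite (_ : _ - _ = (w N - l) + (w' N - l')); last by ring.
apply: le_trans (le_normcD _ _) _; rewrite (splitr e) lerD//.
- by near: N; exact: wl.
- by near: N; exact: wl'.
Unshelve. all: by end_near. Qed.

Lemma ccvgZ (R : realType) (w : nat -> R[i]) (l c : R[i]) :
  ccvg w l -> ccvg (fun N => c * w N) (c * l).
Proof.
move=> wl e e0; have c0 := normc_ge0 c.
have e2 : 0 < e / (Normc.normc c + 1) by rewrite divr_gt0// ltr_wpDl.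
near=> N; rewrite -mulrBr Normc.normcM.
have : Normc.normc (w N - l) <= e / (Normc.normc c + 1) by near: N; exact: wl.
rewrite ler_pdivlMr ?ltr_wpDl// => h; apply: le_trans h.
by rewrite mulrC ler_wpM2l ?normc_ge0// lerDl.
Unshelve. all: by end_near. Qed.

Lemma ccvg_cst (R : realType) (l : R[i]) : ccvg (fun=> l) l.
Proof. by move=> e e0; near=> N; rewrite subrr Normc.normc0 ltW.
Unshelve. all: by end_near. Qed.

Lemma ccvg_sum (R : realType) (I : finType) (w : I -> nat -> R[i]) (l : I -> R[i]) :
  (forall i, ccvg (w i) (l i)) ->
  ccvg (fun N => \sum_i w i N) (\sum_i l i).
Proof.
move=> wl; elim: (index_enum I) => [|i s IH].
  by rewrite big_nil; under eq_fun do rewrite big_nil; exact: ccvg_cst.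
rewrite big_cons; under eq_fun do rewrite big_cons.
exact: ccvgD.
Qed.

Lemma ccvg_le (R : realType) (w : nat -> R[i]) (l : R[i]) (B : R) :
  ccvg w l -> (forall N, Normc.normc (w N) <= B) -> Normc.normc l <= B.
Proof.
move=> wl wB; apply/ler_addgt0Pr => e e0.
have [N _ /(_ N (leqnn _)) h] := wl e e0.
rewrite (_ : l = w N - (w N - l)); last by ring.
apply: le_trans (le_normcD _ _) _.
by rewrite normcN lerD.
Qed.

Lemma ccvg_unique (R : realType) (w : nat -> R[i]) (l l' : R[i]) :
  ccvg w l -> ccvg w l' -> l = l'.
Proof.
move=> wl wl'; apply/eqP; rewrite -subr_eq0; apply/eqP/Normc.eq0_normc.
have h : ccvg (fun=> 0) (l - l').
  have := ccvgD wl (ccvgZ (-1) wl').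
  rewrite mulN1r; congr ccvg; apply/funext => N; ring.
apply/eqP; rewrite eq_le normc_ge0 andbT.
by apply: ccvg_le h _ => N; rewrite Normc.normc0.
Qed.

Lemma ccvg_exists (R : realType) (w : nat -> R[i]) (b : nat -> R) (B : R) :
  (forall N M, (N <= M)%N -> Normc.normc (w M - w N) <= b M - b N) ->
  (forall N, b N <= B) -> exists l, ccvg w l.
Proof.
move=> wb bB.
have real (u : nat -> R) : (forall N M, (N <= M)%N -> `|u M - u N| <= b M - b N) ->
    cvgn u.
  move=> ub.
  have bnd : {homo b : m p / (m <= p)%N >-> m <= p}.
    by move=> m p mp; rewrite -subr_ge0; apply: le_trans (ub _ _ mp).
  have bc : cvgn b.
    apply: nondecreasing_is_cvgn => //.
    by exists B => _ [m _ <-].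
  (* Increments of [u] are at most those of [b] in modulus, so [b \+ u] is again nondecreasing and
     bounded, and [u] is a difference of two convergent sequences. *)
  have bu : cvgn (b \+ u).
    apply: nondecreasing_is_cvgn.
      move=> m p mp; have := ub _ _ mp; rewrite ler_norml => /andP[+ _] /=; lra.
    exists (B + (`|u 0%N| + (B - b 0%N))) => _ [m _ <-] /=.
    apply: lerD => //; rewrite -lerBlDl; apply: le_trans (lerB (bB m) (lexx _)).
    by apply: le_trans (ub _ _ (leq0n m)); apply: le_trans (ler_norm _); rewrite lerB// ler_norm.
  rewrite (_ : u = (b \+ u) \- b); first exact: is_cvgB.
  by apply/funext => m /=; rewrite addrC addKr.
have Rc : cvgn (fun N => complex.Re (w N)).
  apply: real => N M NM; apply: le_trans (wb _ _ NM).
  by apply: le_trans (Re_le_normc _); case: (w M) (w N) => ? ? [].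
have Ic : cvgn (fun N => complex.Im (w N)).
  apply: real => N M NM; apply: le_trans (wb _ _ NM).
  by apply: le_trans (Im_le_normc _); case: (w M) (w N) => ? ? [].
exists (limn (fun N => complex.Re (w N)) +i* limn (fun N => complex.Im (w N))).
move=> e e0; have e2 : 0 < e / 2 by rewrite divr_gt0.
near=> N.
have h1 : `|limn (fun N => complex.Re (w N)) - complex.Re (w N)| <= e / 2.
  by near: N; move/cvgrPdist_le : Rc; exact.
have h2 : `|limn (fun N => complex.Im (w N)) - complex.Im (w N)| <= e / 2.
  by near: N; move/cvgrPdist_le : Ic; exact.
rewrite (splitr e); apply: le_trans (lerD h1 h2).
rewrite distrC (distrC (limn _)).
by case: (w N) => a b'; exact: normc_le_sum.
Unshelve. all: by end_near. Qed.

Lemma cube_sum_ccvg (R : realType) (n : nat) (F : {ffun 'I_n -> nat} -> R[i])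
    (B q : R) : 0 <= B -> 0 <= q < 1 ->
  (forall a, Normc.normc (F a) <= B * q ^+ mabs a) ->
  exists l, ccvg (fun N => cube_sum N F) l.
Proof.
move=> B0 q01 FB.
apply: (@ccvg_exists _ _ (fun N => cube_sum N (fun a => B * q ^+ mabs a))
  (B * ((1 - q)^-1) ^+ n)).
  by move=> N M NM; exact: cube_sum_cauchy.
by move=> N; rewrite /cube_sum -mulr_sumr ler_wpM2l//; exact: cube_sum_geometric.
Qed.

Lemma normc_cube_sum_le (R : realType) (n N : nat)
    (F : {ffun 'I_n -> nat} -> R[i]) (B q : R) : 0 <= B -> 0 <= q < 1 ->
  (forall a, Normc.normc (F a) <= B * q ^+ mabs a) ->
  Normc.normc (cube_sum N F) <= B * ((1 - q)^-1) ^+ n.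
Proof.
move=> B0 q01 FB.
apply: (@le_trans _ _ (cube_sum N (fun a => B * q ^+ mabs a))).
  by apply: normc_sum => a _; exact: FB.
by rewrite /cube_sum -mulr_sumr ler_wpM2l//; exact: cube_sum_geometric.
Qed.

Definition mono (K : comPzRingType) (n : nat) (a : {ffun 'I_n -> nat})
  (z : 'rV[K]_n) : K := \prod_i z 0 i ^+ a i.

(* Quantitative first-order expansion: [p], its differential [g] and the
   remainder are dominated by the first coefficients of [(rho + s)^k], whose sum
   [A] is then submultiplicative. *)
Definition jet (K : numFieldType) (n : nat) (z : 'rV[K]_n) (p : 'rV[K]_n -> K)
    (A : K) : Prop :=
  exists (g : 'I_n -> K) (a0 a1 a2 : K),
    [/\ 0 <= a0, 0 <= a1, 0 <= a2 & a0 + a1 + a2 = A] /\ `|p z| <= a0 /\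
    forall (d : 'rV[K]_n) (s : K), 0 <= s <= 1 -> (forall j, `|d 0 j| <= s) ->
      `|linear_form g d| <= s * a1 /\
      `|p (z + d) - p z - linear_form g d| <= s ^+ 2 * a2.

Lemma jet_mul_coord (K : numFieldType) (n : nat) (z : 'rV[K]_n) (rho : K)
    (p : 'rV[K]_n -> K) (A : K) (i : 'I_n) :
  0 <= rho -> `|z 0 i| <= rho -> jet z p A ->
  jet z (fun y => p y * y 0 i) (A * (rho + 1)).
Proof.
move=> r0 zr [g [a0 [a1 [a2 [[a00 a10 a20 aA] [pz H]]]]]].
exists (fun j => g j * z 0 i + (j == i)%:R * p z).
(* The three lines of the product rule. The remainder is the old one times [z 0 i + d 0 i], of
   modulus at most [rho + 1] since [s <= 1], plus the cross term of the two differentials. *)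
exists (a0 * rho), (a1 * rho + a0), (a2 * (rho + 1) + a1).
split.
  split; rewrite ?addr_ge0 ?mulr_ge0 ?addr_ge0//.
  by rewrite -aA; ring.
split; first by rewrite normrM ler_pM.
move=> d s s01 ds; have [hL hr] := H d s s01 ds.
have /andP[s0 s1] := s01.
have LE : linear_form (fun j => g j * z 0 i + (j == i)%:R * p z) d
        = linear_form g d * z 0 i + p z * d 0 i.
  rewrite /linear_form mulr_suml.
  under eq_bigr do rewrite mulrDl.
  rewrite big_split /=; congr (_ + _).
    by apply: eq_bigr => j _; rewrite mulrAC.
  rewrite (bigD1 i)//= eqxx mul1r big1 ?addr0// => j /negPf ->.
  by rewrite !mul0r.
rewrite LE; split.
  apply: le_trans (ler_normD _ _) _; rewrite !normrM mulrDr; apply: lerD.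
    by rewrite mulrA ler_pM.
  by rewrite mulrC ler_pM.
have -> : p (z + d) * (z + d) 0 i - p z * z 0 i -
    (linear_form g d * z 0 i + p z * d 0 i)
  = (p (z + d) - p z - linear_form g d) * (z 0 i + d 0 i)
    + linear_form g d * d 0 i by rewrite mxE; ring.
apply: le_trans (ler_normD _ _) _; rewrite !normrM mulrDr; apply: lerD.
  rewrite mulrA ler_pM//; apply: le_trans (ler_normD _ _) _.
  by rewrite lerD//; exact: le_trans s1.
by rewrite expr2 mulrAC ler_pM.
Qed.

(** Monomials are built one coordinate factor at a time. The same purely geometric bound controls
    value, differential and remainder, so one decay estimate on coefficients sums all three. *)
Lemma jet_mono (K : numFieldType) (n : nat) (z : 'rV[K]_n) (rho : K)
    (a : {ffun 'I_n -> nat}) :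
  0 <= rho -> (forall i, `|z 0 i| <= rho) ->
  jet z (mono a) ((rho + 1) ^+ mabs a).
Proof.
move=> r0 zr; rewrite /mono /mabs.
elim: (index_enum _) => [|i s IH].
  rewrite big_nil [X in jet _ X _](_ : _ = fun=> 1); last first.
    by apply/funext => y; rewrite big_nil.
  exists (fun=> 0), 1, 0, 0; split; first by split; rewrite ?addr0.
  split; first by rewrite normr1.
  move=> d t _ _; have -> : linear_form (fun=> 0) d = 0.
    by rewrite /linear_form big1// => j _; rewrite mul0r.
  by rewrite subrr subr0 normr0 !mulr0.
rewrite big_cons exprD mulrC [X in jet _ X _](_ : _ =
   fun z : 'rV[K]_n => (\prod_(j <- s) z 0 j ^+ a j) * z 0 i ^+ a i); last first.
  by apply/funext => y; rewrite big_cons mulrC.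
elim: (a i) => [|k IHk].
  rewrite expr0 mulr1; under [X in jet _ X _]eq_fun do rewrite expr0 mulr1.
  exact: IH.
rewrite exprSr mulrA; under [X in jet _ X _]eq_fun do rewrite exprSr mulrA.
exact: jet_mul_coord.
Qed.

Lemma jet_bounds (K : numFieldType) (n : nat) (z : 'rV[K]_n) (p : 'rV[K]_n -> K)
    (A : K) : jet z p A -> exists g : 'I_n -> K,
  [/\ `|p z| <= A, forall j, `|g j| <= A &
   forall (d : 'rV[K]_n) (s : K), 0 <= s <= 1 -> (forall j, `|d 0 j| <= s) ->
      `|p (z + d) - p z - linear_form g d| <= A * s ^+ 2].
Proof.
move=> [g [a0 [a1 [a2 [[a00 a10 a20 <-] [pz H]]]]]]; exists g; split.
- by apply: (le_trans pz); rewrite -addrA lerDl addr_ge0.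
- move=> j; have [|i|+ _] := H (delta_mx 0 j) 1; first by rewrite lexx ler01.
    by rewrite !mxE; case: (_ && _); rewrite ?normr1 ?normr0 ?lexx ?ler01.
  rewrite /linear_form (bigD1 j)//= mxE !eqxx mulr1 mul1r big1 ?addr0.
    by move=> /le_trans; apply; rewrite addrAC lerDr addr_ge0.
  by move=> i /negPf ij; rewrite mxE ij andbF mulr0.
- move=> d s s01 ds; have [_ /le_trans] := H d s s01 ds; apply.
  have /andP[s0 _] := s01.
  by rewrite mulrC ler_wpM2r ?exprn_ge0// lerDr addr_ge0.
Qed.

(** The first-order expansions of the monomials are added up; their quadratic bound is uniform in
    [N] and passes to the limit, so no theorem on term-by-term differentiation is involved. *)
Lemma power_series_entire (R : realType) (n : nat)
    (c : {ffun 'I_n -> nat} -> R[i]) :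
  (forall r : R, 1 <= r -> exists2 B : R, 0 <= B &
     forall a, Normc.normc (c a) * r ^+ mabs a <= B) ->
  exists P : 'rV[R[i]]_n -> R[i], entire P /\
    forall z, ccvg (fun N => cube_sum N (fun a => c a * mono a z)) (P z).
Proof.
move=> cB.
have half01 : 0 <= (2^-1 : R) < 1 by rewrite invr_ge0 ler0n invf_lt1// ltr1n.
(* Taking the radius [2 * (rho + 1)] in the hypothesis leaves the ratio 1/2 once
   [(rho + 1) ^+ mabs a] is absorbed. *)
have decay (rho : R) : 0 <= rho -> exists2 B : R, 0 <= B &
    forall a, Normc.normc (c a) * (rho + 1) ^+ mabs a <= B * 2^-1 ^+ mabs a.
  move=> r0; have [|B B0 hB] := cB (2 * (rho + 1)); first lra.
  exists B => // a; rewrite exprVn ler_pdivlMr ?exprn_gt0// -mulrA -exprMn.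
  by rewrite (mulrC _ 2).
pose radius (z : 'rV[R[i]]_n) : R := \sum_j Normc.normc (z 0 j).
have radius_ge0 (z : 'rV[R[i]]_n) : 0 <= radius z by apply: sumr_ge0 => j _; exact: normc_ge0.
have radiusP (z : 'rV[R[i]]_n) j : `|z 0 j| <= (radius z)%:C.
  rewrite normr_normc lecR /radius (bigD1 j)//= lerDl.
  by apply: sumr_ge0 => i _; exact: normc_ge0.
have Jets (z : 'rV[R[i]]_n) : forall a, exists g : 'I_n -> R[i],
   [/\ Normc.normc (mono a z) <= (radius z + 1) ^+ mabs a,
     forall j, Normc.normc (g j) <= (radius z + 1) ^+ mabs a &
     forall (d : 'rV[R[i]]_n) (s : R), 0 <= s <= 1 ->
       (forall j, Normc.normc (d 0 j) <= s) ->
       Normc.normc (mono a (z + d) - mono a z - linear_form g d)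
         <= (radius z + 1) ^+ mabs a * s ^+ 2].
  move=> a; have r0 : 0 <= (radius z)%:C by rewrite lecR.
  have [g] := jet_bounds (jet_mono a r0 (radiusP z)).
  have -> : ((radius z)%:C + 1) ^+ mabs a = ((radius z + 1) ^+ mabs a)%:C.
    by rewrite rmorphXn rmorphD.
  rewrite normr_normc lecR => -[h1 h2 h3]; exists g; split=> //.
    by move=> j; have := h2 j; rewrite normr_normc lecR.
  move=> d s s01 ds; have := h3 d s%:C; rewrite !lecR s01 => /(_ isT).
  rewrite normr_normc -rmorphXn -rmorphM lecR; apply=> j.
  by rewrite normr_normc lecR.
have Pex (z : 'rV[R[i]]_n) : exists l, ccvg (fun N => cube_sum N (fun a => c a * mono a z)) l.
  have [B B0 hB] := decay _ (radius_ge0 z).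
  apply: (cube_sum_ccvg B0 half01) => a.
  have [g [h1 _ _]] := Jets z a.
  by rewrite Normc.normcM; apply: le_trans (hB a); rewrite ler_wpM2l ?normc_ge0.
have /choice[P PE] := Pex.
exists P; split=> // z.
have [B B0 hB] := decay _ (radius_ge0 z).
have /choice[g gE] := Jets z.
(* [G] is the candidate gradient of [P] at [z], the sum of the gradients of the terms. *)
have /choice[G GE] : forall j, exists l, ccvg (fun N => cube_sum N (fun a => c a * g a j)) l.
  move=> j; apply: (cube_sum_ccvg B0 half01) => a; have [_ h2 _] := gE a.
  by rewrite Normc.normcM; apply: le_trans (hB a); rewrite ler_wpM2l ?normc_ge0.
pose C := B * ((1 - 2^-1)^-1) ^+ n.
have C0 : 0 <= C.
  by rewrite /C mulr_ge0// exprn_ge0// invr_ge0 subr_ge0; case/andP: half01 => _ /ltW.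
apply: (@differentiable_of_quadratic _ _ P z G C%:C); first by rewrite lecR.
move=> d sc scI ds; have [s sE] : exists s : R, sc = s%:C.
  exists (complex.Re sc); case/andP: scI => + _; case: (sc) => a b.
  by rewrite lecE /= => /andP[/eqP-> _].
rewrite {}sE in scI ds *.
have s01 : 0 <= s <= 1 by move: scI; rewrite !lecR.
have s0 : 0 <= s by case/andP: s01.
have {}ds j : Normc.normc (d 0 j) <= s by have := ds j; rewrite normr_normc lecR.
rewrite -rmorphXn -rmorphM normr_normc lecR.
have lim : ccvg (fun N => cube_sum N (fun a =>
    c a * (mono a (z + d) - mono a z - linear_form (g a) d)))
    (P (z + d) - P z - linear_form G d).
  have h := ccvg_sum (fun j => ccvgZ (d 0 j) (GE j)).
  have := ccvgD (ccvgD (PE (z + d)) (ccvgZ (-1) (PE z))) (ccvgZ (-1) h).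
  rewrite !mulN1r (_ : \sum_j _ = linear_form G d); last first.
    by apply: eq_bigr => j _; rewrite mulrC.
  congr ccvg; apply/funext => N; rewrite !mulN1r /cube_sum.
  under [X in _ = X]eq_bigr do rewrite !mulrBr.
  rewrite !sumrB; congr (_ - _).
  under [X in _ = X]eq_bigr do rewrite mulr_sumr.
  rewrite exchange_big /=; apply: eq_bigr => j _.
  by rewrite mulr_sumr; apply: eq_bigr => a _; ring.
apply: (ccvg_le lim) => N.
have Bs : 0 <= B * s ^+ 2 by rewrite mulr_ge0// exprn_ge0.
have := @normc_cube_sum_le R n N _ _ _ Bs half01
  (fun a => _ : Normc.normc (c a * (mono a (z + d) - mono a z - linear_form (g a) d))
      <= B * s ^+ 2 * 2^-1 ^+ mabs a).
rewrite /C mulrAC; apply=> a; have [_ _ h3] := gE a.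
rewrite Normc.normcM (mulrAC B); apply: (@le_trans _ _
  (Normc.normc (c a) * ((radius z + 1) ^+ mabs a * s ^+ 2))).
  by rewrite ler_wpM2l ?normc_ge0// h3.
by rewrite mulrA ler_wpM2r ?exprn_ge0.
Qed.

(** * Taylor expansion over cubes of multi-indices *)

(** The derivative of the remainder of [g 0] is the remainder of [g 1] of one order less. The bound
    minus the signed remainder starts at 0 with nonnegative derivative; the sign [e] treats both
    inequalities. *)
Lemma taylor_bound (R : realType) (N : nat) (g : nat -> R -> R) (M : R) :
  (forall k (x : R), is_derive x 1 (g k) (g k.+1 x)) ->
  (forall x, `|g N x| <= M) ->
  forall t, 0 <= t ->
  `|g 0%N t - \sum_(k < N) g k 0 * (t ^+ k / k`!%:R)| <= M * (t ^+ N / N`!%:R).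
Proof.
elim: N g => [|N IH] g gE gM t t0.
  by rewrite big_ord0 subr0 expr0 fact0 divr1 mulr1.
have dX (k : nat) (x : R) :
    is_derive x 1 (fun s : R => s ^+ k.+1 / k.+1`!%:R) (x ^+ k / k`!%:R).
  have d : is_derive x 1 (fun s : R => s ^+ k.+1) (k.+1%:R *: x ^+ k *: 1).
    by apply: DeriveDef; [exact: exprn_derivable|exact: exp_derive].
  have h := is_deriveM d (is_derive_cst (k.+1`!%:R^-1 : R) x 1).
  apply: is_derive_eq h _.
  rewrite scaler0 add0r /GRing.scale /= mulr1 factS natrM.
  have a0 : (k.+1%:R : R) != 0 by rewrite pnatr_eq0.
  have b0 : (k`!%:R : R) != 0 by rewrite pnatr_eq0 -lt0n fact_gt0.
  by move: a0 b0; set a := k.+1%:R; set b := k`!%:R => a0 b0; field; rewrite b0 nat1r.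
pose P (s : R) := \sum_(k < N.+1) g k 0 * (s ^+ k / k`!%:R).
have dP (x : R) : is_derive x 1 P (\sum_(k < N) g k.+1 0 * (x ^+ k / k`!%:R)).
  have -> : P = cst (g 0%N 0) +
      \sum_(k < N) (cst (g k.+1 0) * (fun s : R => s ^+ k.+1 / k.+1`!%:R)).
    apply/funext => s; rewrite /P big_ord_recl /= expr0 fact0 divr1 mulr1.
    by rewrite fctE fct_sumE.
  have := @is_derive_sum R R R N
    (fun k => cst (g k.+1 0) * (fun s : R => s ^+ k.+1 / k.+1`!%:R)) x 1
    (fun k => g k.+1 0 * (x ^+ k / k`!%:R)).
  move=> /(_ _)/wrap[k|dS].
    have h := is_deriveM (is_derive_cst (g k.+1 0) x 1) (dX k x).
    by apply: is_derive_eq h _; rewrite scaler0 addr0.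
  by have h := is_deriveD (is_derive_cst (g 0%N 0) x 1) dS;
    apply: is_derive_eq h _; rewrite add0r.
have P0 : P 0 = g 0%N 0.
  rewrite /P big_ord_recl /= expr0 fact0 divr1 mulr1 big1 ?addr0// => k _.
  by rewrite expr0n /= mul0r mulr0.
have {}IH s : 0 <= s ->
    `|g 1%N s - \sum_(k < N) g k.+1 0 * (s ^+ k / k`!%:R)| <= M * (s ^+ N / N`!%:R).
  by move=> s0; apply: (IH (fun k => g k.+1)) => // k x; exact: gE.
have main (e : R) : e = 1 \/ e = -1 ->
    e * (g 0%N t - P t) <= M * (t ^+ N.+1 / N.+1`!%:R).
  move=> e1.
  pose D (s : R) := M * (s ^+ N.+1 / N.+1`!%:R) - e * (g 0%N s - P s).
  have dD (x : R) : is_derive x 1 D (M * (x ^+ N / N`!%:R)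
      - e * (g 1%N x - \sum_(k < N) g k.+1 0 * (x ^+ k / k`!%:R))).
    have h1 := is_deriveM (is_derive_cst M x 1) (dX N x).
    have h2 := is_deriveM (is_derive_cst e x 1) (is_deriveB (gE 0%N x) (dP x)).
    have h := is_deriveB h1 h2.
    by apply: is_derive_eq h _; rewrite !scaler0 !addr0.
  have [s] := @MVT_segment R D _ 0 t t0 (fun x _ => dD x)
    (continuous_subspaceT (fun x => is_derive_continuous (dD x))).
  rewrite in_itv/= => /andP[s0 _].
  rewrite {2}/D P0 subrr mulr0 expr0n /= mul0r mulr0 !subr0 => Dt.
  suff : 0 <= D t by rewrite /D subr_ge0.
  rewrite Dt mulr_ge0// subr_ge0.
  have := IH s s0; rewrite ler_norml => /andP[h1 h2].
  by case: e1 => ->; [rewrite mul1r|rewrite mulN1r lerNl].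
rewrite ler_norml -/(P t); apply/andP; split.
  by have := main (-1) (or_intror erefl); rewrite mulN1r lerNl.
by have := main 1 (or_introl erefl); rewrite mul1r.
Qed.

Lemma is_derive_line (R : realType) (n : nat) (w : 'rV[R]_n -> R)
    (x v : 'rV[R]_n) (h t : R) :
  (forall y, derivable w y v) ->
  is_derive t 1 (fun s => w (x + (s * h) *: v)) (h * 'D_v w (x + (t * h) *: v)).
Proof.
move=> dw; set a := x + _.
have d0 : is_derive (0 : R) 1 (fun s => w (s *: v + a)) ('D_v w a).
  apply: DeriveDef; first exact: ((derivable1P w a v).1 (dw a)).
  rewrite /derive; set g1 := (fun _ => _); set g2 := (fun _ => _).
  have -> : g1 = g2; last by [].
  by apply/funext => s; rewrite /g1 /g2 /= addr0 scale0r add0r /GRing.scale /= mulr1.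
have d1 : is_derive t 1 (fun s : R => (s - t) * h) h.
  have e := is_deriveM (is_deriveB (is_derive_id t 1) (is_derive_cst t t 1))
    (is_derive_cst h t 1).
  by apply: is_derive_eq e _; rewrite scaler0 add0r subr0 /GRing.scale/= mulr1.
have d0' : is_derive ((fun s : R => (s - t) * h) t) 1
    (fun s => w (s *: v + a)) ('D_v w a) by rewrite subrr mul0r.
have := @is_derive1_comp R (fun s => w (s *: v + a)) (fun s => (s - t) * h) t _ _ d0' d1.
rewrite mulrC; congr is_derive; apply/funext => s /=; congr w.
by rewrite /a addrCA -scalerDl; congr (_ + _ *: _); ring.
Qed.

Definition upd (n : nat) (T : Type) (b : {ffun 'I_n -> T}) (j : 'I_n) (k : T) :
  {ffun 'I_n -> T} := [ffun i => if i == j then k else b i].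

Lemma cube_index_upd (n N : nat) (b : {ffun 'I_n -> 'I_N.+1}) (j : 'I_n)
    (k : 'I_N.+1) : cube_index (upd b j k) = upd (cube_index b) j k.
Proof. by apply/ffunP => i; rewrite !ffunE; case: eqP. Qed.

Lemma mabs_upd (n : nat) (b : {ffun 'I_n -> nat}) (j : 'I_n) (k : nat) :
  b j = 0%N -> mabs (upd b j k) = (mabs b + k)%N.
Proof.
move=> bj; rewrite /mabs (bigD1 j)//= ffunE eqxx [in RHS](bigD1 j)//= bj add0n addnC.
by congr (_ + _)%N; apply: eq_bigr => i /negPf ij; rewrite ffunE ij.
Qed.

Lemma mfact_upd (n : nat) (b : {ffun 'I_n -> nat}) (j : 'I_n) (k : nat) :
  b j = 0%N -> mfact (upd b j k) = (mfact b * k`!)%N.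
Proof.
move=> bj; rewrite /mfact (bigD1 j)//= ffunE eqxx [in RHS](bigD1 j)//= bj fact0.
rewrite mul1n mulnC.
by congr (_ * _)%N; apply: eq_bigr => i /negPf ij; rewrite ffunE ij.
Qed.

Lemma mono_upd (K : comPzRingType) (n : nat) (h : 'rV[K]_n)
    (b : {ffun 'I_n -> nat}) (j : 'I_n) (k : nat) :
  b j = 0%N -> mono (upd b j k) h = mono b h * h 0 j ^+ k.
Proof.
move=> bj; rewrite /mono (bigD1 j)//= ffunE eqxx [in RHS](bigD1 j)//= bj expr0.
rewrite mul1r mulrC.
by congr (_ * _); apply: eq_bigr => i /negPf ij; rewrite ffunE ij.
Qed.

(** [mderiv_real] applies small indices last. With no derivatives in coordinates up to [j], those
    added in [j] are outermost. *)
Lemma mderiv_upd (R : realType) (n : nat) (b : {ffun 'I_n -> nat}) (j : 'I_n)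
    (k : nat) (u : 'rV[R]_n -> R) : (forall i : 'I_n, (i <= j)%N -> b i = 0%N) ->
  mderiv_real (upd b j k) u = iter k (partial_deriv j) (mderiv_real b u).
Proof.
move=> b0; rewrite /mderiv_real.
have : sorted (fun i i' : 'I_n => (i < i')%N) (enum 'I_n).
  have := iota_ltn_sorted 0 n; rewrite -val_enum_ord sorted_map.
  by [].
have : j \in enum 'I_n by rewrite mem_enum.
elim: (enum 'I_n) => [//|i s IH]; rewrite inE => /orP[/eqP<-|js] /= is_.
  rewrite ffunE eqxx b0//=; congr iter.
  have : all (fun i : 'I_n => (j < i)%N) s.
    by apply: order_path_min is_ => ? ? ?; exact: ltn_trans.
  elim: s {IH is_} => [//|i' s IH] /= /andP[ji' js].
  by rewrite IH// ffunE; case: eqP => // ij; rewrite ij ltnn in ji'.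
have ij : (i < j)%N.
  have /allP := order_path_min (leT := fun i i' : 'I_n => (i < i')%N)
    (fun _ _ _ => @ltn_trans _ _ _) is_.
  exact.
have ijE : i == j = false by apply/eqP => e; rewrite e ltnn in ij.
rewrite ffunE ijE b0 1?ltnW//=.
by apply: IH => //; exact: path_sorted is_.
Qed.

Lemma mderiv0 (R : realType) (n : nat) (b : {ffun 'I_n -> nat})
    (u : 'rV[R]_n -> R) : (forall i, b i = 0%N) -> mderiv_real b u = u.
Proof.
by move=> b0; rewrite /mderiv_real; elim: (enum _) => //= i s ->; rewrite b0.
Qed.

Lemma mderiv_foldr (R : realType) (n : nat) (b : {ffun 'I_n -> nat})
    (u : 'rV[R]_n -> R) : exists s : seq 'I_n,
  mderiv_real b u = foldr (@partial_deriv R n) u s.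
Proof.
rewrite /mderiv_real; elim: (enum _) => [|i s [w IH]] /=; first by exists [::].
by exists (nseq (b i) i ++ w); rewrite IH foldr_cat; elim: (b i) => //= k ->.
Qed.

Section cube_taylor.
Variables (R : realType) (n N : nat) (u : 'rV[R]_n -> R) (B r q : R).
Hypotheses (us : smooth_real u) (B0 : 0 <= B) (r0 : 0 < r) (q01 : 0 <= q < 1).
Hypothesis uB : forall (a : {ffun 'I_n -> nat}) x,
  `|mderiv_real a u x| * r ^+ mabs a <= B * (mfact a)%:R.
Variables (a h : 'rV[R]_n).
Hypothesis hq : forall i, `|h 0 i| <= q * r.

(* [partial_sum j] interpolates between the Taylor sum [j = 0] and [u (a + h)]
   [j = n]; going from [j.+1] to [j] expands in coordinate [j]. This is the order in
   which [mderiv_real] composes, so partial derivatives never need to commute. *)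
Let term (x : 'rV[R]_n) (b : {ffun 'I_n -> nat}) : R :=
  mderiv_real b u x * (mono b h / (mfact b)%:R).

Let below (j : nat) (b : {ffun 'I_n -> nat}) : bool :=
  [forall i : 'I_n, (i < j)%N ==> (b i == 0%N)].

Let point (j : nat) : 'rV[R]_n :=
  \row_i (a 0 i + (if (i < j)%N then h 0 i else 0)).

Let partial_sum (j : nat) : R :=
  \sum_(b : {ffun 'I_n -> 'I_N.+1} | below j (cube_index b))
    term (point j) (cube_index b).

Let mfact_gt0 (b : {ffun 'I_n -> nat}) : 0 < (mfact b)%:R :> R.
Proof. by rewrite ltr0n /mfact prodn_gt0// => i; exact: fact_gt0. Qed.

Let mono_le (b : {ffun 'I_n -> nat}) : `|mono b h| <= (q * r) ^+ mabs b.
Proof.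
rewrite /mono /mabs normr_prod -prodrXr.
apply: ler_prod => i _; rewrite normr_ge0 normrX.
by rewrite lerXn2r ?nnegrE// (le_trans _ (hq i)).
Qed.

Let one_step (j : 'I_n) (b : {ffun 'I_n -> nat}) : below j.+1 b ->
  `|term (point j.+1) b - \sum_(k < N.+1) term (point j) (upd b j k)|
    <= B * q ^+ N.+1 * q ^+ mabs b.
Proof.
move=> /forallP bj; have {}bj (i : 'I_n) : (i <= j)%N -> b i = 0%N.
  by move=> ij; have /implyP/(_ ij)/eqP := bj i.
have bj0 : b j = 0%N by exact: bj.
pose e : 'rV[R]_n := delta_mx 0 j.
pose w k := iter k (partial_deriv j) (mderiv_real b u).
have wE k : w k = mderiv_real (upd b j k) u by rewrite mderiv_upd.
have wd k y : derivable (w k) y e.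
  have [s sE] := mderiv_foldr (upd b j k) u.
  by rewrite wE sE; have [_] := us s; apply.
(* Scaling by [h 0 j] runs the segment over [0 <= t <= 1] whatever the sign of [h 0 j]; its powers
   are the chain-rule factors. *)
pose g k (t : R) := h 0 j ^+ k * w k (point j + (t * h 0 j) *: e).
have gE k (t : R) : is_derive t 1 (g k) (g k.+1 t).
  have d := is_deriveM (is_derive_cst (h 0 j ^+ k) t 1)
    (is_derive_line (point j) (h 0 j) t (wd k)).
  by apply: is_derive_eq d _; rewrite scaler0 addr0 /g exprSr /GRing.scale /= mulrA.
set c := mono b h / (mfact b)%:R.
have qr0 : 0 <= q * r by rewrite mulr_ge0 ?(ltW r0)//; case/andP: q01.
(* The two factorials cancel those of the Taylor remainder and of [term], and [r ^+ mabs b] cancels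
   against [mono_le], leaving powers of [q] only. *)
have gB (t : R) : `|g N.+1 t| <=
    B * ((mfact b)%:R * N.+1`!%:R) * q ^+ N.+1 / r ^+ mabs b.
  have := uB (upd b j N.+1) (point j + (t * h 0 j) *: e).
  rewrite -wE mabs_upd// mfact_upd// natrM => hb.
  have rn k : 0 < r ^+ k by exact: exprn_gt0.
  rewrite ler_pdivlMr// /g normrM normrX.
  have h1 : `|h 0 j| ^+ N.+1 <= q ^+ N.+1 * r ^+ N.+1.
    by rewrite -exprMn lerXn2r ?nnegrE.
  apply: (@le_trans _ _ (q ^+ N.+1 * r ^+ N.+1 *
      `|w N.+1 (point j + (t * h 0 j) *: e)| * r ^+ mabs b)).
    by rewrite ler_wpM2r ?(ltW (rn _))// ler_wpM2r.
  rewrite [leRHS]mulrC (_ : _ * r ^+ mabs b = q ^+ N.+1 *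
    (`|w N.+1 (point j + (t * h 0 j) *: e)| * r ^+ (mabs b + N.+1))); last first.
    by rewrite exprD; ring.
  by rewrite ler_wpM2l// exprn_ge0//; case/andP: q01.
have pE : point j.+1 = point j + (1 * h 0 j) *: e.
  apply/rowP => i; rewrite !mxE eqxx /= mul1r ltnS leq_eqVlt.
  have [->|ij] := eqVneq i j; first by rewrite eqxx ltnn /= mulr1 addr0.
  by rewrite (negPf (ij : val i != val j)) /= mulr0 addr0.
have := taylor_bound gE gB ler01.
rewrite expr1n mul1r.
have -> : g 0%N 1 = w 0%N (point j.+1) by rewrite /g expr0 mul1r pE.
under eq_bigr do rewrite expr1n mul1r.
move=> T.
have -> : term (point j.+1) b - \sum_(k < N.+1) term (point j) (upd b j k)
  = c * (w 0%N (point j.+1) - \sum_(k < N.+1) g k 0 * k`!%:R^-1).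
  rewrite mulrBr; congr (_ - _); first by rewrite mulrC.
  rewrite mulr_sumr; apply: eq_bigr => k _.
  rewrite /term -wE mono_upd// mfact_upd// /g mul0r scale0r addr0 natrM /c invfM.
  by ring.
rewrite normrM; apply: le_trans (ler_wpM2l (normr_ge0 c) T) _.
have cE : `|c| <= (q * r) ^+ mabs b / (mfact b)%:R.
  rewrite /c normrM normfV (gtr0_norm (mfact_gt0 b)).
  apply: ler_wpM2r; last exact: mono_le.
  by rewrite invr_ge0 ltW.
have q0 : 0 <= q by case/andP: q01.
apply: le_trans (ler_wpM2r _ cE) _.
  by rewrite !mulr_ge0 ?invr_ge0 ?exprn_ge0 ?(ltW r0).
rewrite exprMn le_eqVlt; apply/orP; left; apply/eqP.
have f0 : (mfact b)%:R != 0 :> R by rewrite gt_eqF.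
have f1 : (N.+1`!)%:R != 0 :> R by rewrite pnatr_eq0 -lt0n fact_gt0.
have rn0 : r ^+ mabs b != 0 by rewrite gt_eqF// exprn_gt0.
move: f0 f1 rn0; set x1 := (mfact b)%:R; set x2 := (N.+1`!)%:R.
set x3 := r ^+ mabs b; set x4 := q ^+ mabs b; set x5 := q ^+ N.+1.
by move=> f0 f1 rn0; field; rewrite f0 f1 rn0.
Qed.

Let partial_sum_step (j : 'I_n) :
  `|partial_sum j.+1 - partial_sum j| <= B * q ^+ N.+1 * ((1 - q)^-1) ^+ n.
Proof.
have -> : partial_sum j =
  \sum_(b : {ffun 'I_n -> 'I_N.+1} | below j.+1 (cube_index b))
    \sum_(k < N.+1) term (point j) (upd (cube_index b) j k).
  rewrite /partial_sum.
  (* Multi-indices are grouped by erasing entry [j]; each group is the set of [upd b j k] for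
     [k <= N]. *)
  rewrite (partition_big (fun b : {ffun 'I_n -> 'I_N.+1} => upd b j ord0)
    (fun b => below j.+1 (cube_index b))) /=; last first.
    move=> b /forallP bj; apply/forallP => i; apply/implyP; rewrite ltnS !ffunE => ij.
    have [//|ne] := eqVneq i j; have := bj i.
    by rewrite ffunE ltn_neqAle ij andbT (ne : val i != val j) /=.
  apply: eq_bigr => b /forallP bj.
  have bj0 (i : 'I_n) : (i <= j)%N -> b i = ord0.
    by move=> ij; have /implyP/(_ ij) := bj i; rewrite ffunE => /eqP e; exact: val_inj.
  rewrite (reindex_onto (fun k => upd b j k) (fun b' => b' j)) /=; last first.
    move=> b' /andP[_ /eqP <-]; apply/ffunP => i; rewrite !ffunE.
    by case: eqVneq => // ->.
  apply: eq_big => [k|k _]; last by rewrite cube_index_upd.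
  rewrite ffunE eqxx eqxx andbT; apply/andP; split.
    apply/forallP => i; apply/implyP => ij; rewrite !ffunE.
    have [e|ne] := eqVneq i j; first by rewrite e ltnn in ij.
    by rewrite bj0// ltnW.
  apply/eqP/ffunP => i; rewrite !ffunE; have [->|//] := eqVneq i j.
  by rewrite bj0.
rewrite /partial_sum -sumrB.
apply: le_trans (ler_norm_sum _ _ _) _.
apply: (@le_trans _ _ (cube_sum N (fun b : {ffun 'I_n -> nat} => B * q ^+ N.+1 * q ^+ mabs b))).
  rewrite /cube_sum [leRHS](bigID (fun b => below j.+1 (cube_index b))) /= -[leLHS]addr0.
  have q0 : 0 <= q by case/andP: q01.
  apply: lerD; last by apply: sumr_ge0 => b _; rewrite !mulr_ge0 ?exprn_ge0.
  by apply: ler_sum => b bj; exact: one_step.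
rewrite /cube_sum -mulr_sumr ler_wpM2l//; last exact: cube_sum_geometric.
by rewrite mulr_ge0// exprn_ge0//; case/andP: q01.
Qed.

(** The [n] single-coordinate errors telescope. With [B], [r] and [q < 1] fixed, the bound tends to
    0 as [N] grows. *)
Lemma cube_taylor :
  `|u (a + h) - cube_sum N (fun b => mderiv_real b u a * (mono b h / (mfact b)%:R))|
    <= n%:R * (B * q ^+ N.+1 * ((1 - q)^-1) ^+ n).
Proof.
have pn : partial_sum n = u (a + h).
  rewrite /partial_sum (bigD1 [ffun=> ord0])/=; last first.
    by apply/forallP => i; rewrite !ffunE implybT.
  rewrite big1 ?addr0 => [|b /andP[/forallP bn /eqP b0]]; last first.
    exfalso; apply: b0; apply/ffunP => i; apply: val_inj; rewrite ffunE.
    by have := bn i; rewrite ltn_ord ffunE => /eqP.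
  rewrite /term mderiv0 => [|i]; last by rewrite !ffunE.
  rewrite (_ : mono _ h = 1); last first.
    by rewrite /mono big1// => i _; rewrite !ffunE expr0.
  rewrite (_ : mfact _ = 1%N); last first.
    by rewrite /mfact big1// => i _; rewrite !ffunE.
  by rewrite divr1 mulr1; congr u; apply/rowP => i; rewrite !mxE ltn_ord.
have p0 : partial_sum 0 =
    cube_sum N (fun b => mderiv_real b u a * (mono b h / (mfact b)%:R)).
  rewrite /partial_sum /cube_sum; apply: eq_big => [b|b _].
    by apply/forallP => i.
  by rewrite /term; congr (mderiv_real _ _ _ * _); apply/rowP => i; rewrite !mxE addr0.
rewrite -pn -p0.
have H (j : nat) : (j <= n)%N ->
    `|partial_sum j - partial_sum 0| <= j%:R * (B * q ^+ N.+1 * ((1 - q)^-1) ^+ n).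
  elim: j => [_|j IH jn]; first by rewrite subrr normr0 mul0r.
  rewrite -(subrK (partial_sum j) (partial_sum j.+1)) -addrA.
  apply: le_trans (ler_normD _ _) _.
  rewrite -natr1 mulrDl mul1r [leRHS]addrC; apply: lerD; last exact: IH (ltnW jn).
  exact: (partial_sum_step (Ordinal jn)).
exact: H.
Qed.

End cube_taylor.

(** * Extension and growth *)

Lemma calE_mP (R : realType) (n : nat) (w : R -> R) (m : nat)
    (f : 'rV[R]_n -> R[i]) : calE_m w m f -> smooth f /\ exists2 C : R, 0 <= C &
  forall x (a : {ffun 'I_n -> nat}),
    (1 + enorm x) ^+ m * Normc.normc (mderiv a f x)
      <= C * ((mfact a)%:R * expR (- w (mabs a)%:R)).
Proof.
move=> [fs]; set S := (X in ereal_sup X) => Sfin; split=> //.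
exists `|fine (ereal_sup S)|; first exact: normr_ge0.
move=> x a; set v := _ * _; set d := _ * expR _.
have d0 : 0 < d.
  rewrite mulr_gt0 ?expR_gt0// ltr0n /mfact prodn_gt0// => i.
  exact: fact_gt0.
rewrite -ler_pdivrMr//.
have /ereal_sup_ubound : S (v / d)%:E by exists x => //; exists a.
case: (ereal_sup S) Sfin => [s||] //= _; rewrite lee_fin => /le_trans; apply.
exact: ler_norm.
Qed.

(** This is the supremum tested at [ln r], admissible because [r >= 1]. The real work is boundedness
    of the set, without which [sup] says nothing. *)
Lemma psi_star_lower (R : realType) (Phi : nat -> R -> R) (nu k : nat) (r : R) :
  (forall x y : R, 0 <= x -> x <= y -> Phi nu x <= Phi nu y) ->
  Phi nu x / x @[x --> +oo] --> +oo -> 1 <= r ->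
  k%:R * ln r - Phi nu r <= psi_star Phi nu k%:R.
Proof.
move=> mono_phi /cvgryPge /(_ k%:R) [M [_ hM]] r1.
have r0 : 0 < r by exact: lt_le_trans r1.
apply: ub_le_sup; last first.
  by exists (ln r); [exact: ln_ge0|rewrite /psi lnK].
pose X := `|M| + 1.
have X1 : 1 <= X by rewrite lerDr.
(* If [expR y <= X], then [y <= X] and [Phi nu] is at least [Phi nu 0]; beyond [M],
   [Phi nu (expR y) >= k * expR y >= k * y] makes the value nonpositive. *)
exists (k%:R * X + `|Phi nu 0|) => _ [y y0 <-]; rewrite /psi.
have e0 := expR_gt0 y; have yle := expR_ge1Dx y.
have kX : 0 <= k%:R * X by rewrite mulr_ge0// (le_trans _ X1).
have [yX|Xy] := lerP (expR y) X.
  have h1 : k%:R * y <= k%:R * X by rewrite ler_wpM2l//; lra.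
  have h2 : Phi nu 0 <= Phi nu (expR y) by exact: mono_phi (ltW e0).
  have := ler_norm (- Phi nu 0); rewrite normrN; lra.
have : M < expR y by apply: le_lt_trans Xy; rewrite /X (le_trans (ler_norm M))// lerDl.
move=> /hM; rewrite /= ler_pdivlMr// => h.
have h1 : k%:R * y <= k%:R * expR y by rewrite ler_wpM2l//; lra.
have := normr_ge0 (Phi nu 0); lra.
Qed.

Lemma expR_psi_star_le (R : realType) (Phi : nat -> R -> R) (nu k : nat) (r : R) :
  (forall x y : R, 0 <= x -> x <= y -> Phi nu x <= Phi nu y) ->
  Phi nu x / x @[x --> +oo] --> +oo -> 1 <= r ->
  expR (- psi_star Phi nu k%:R) * r ^+ k <= expR (Phi nu r).
Proof.
move=> mono_phi lim_phi r1; have r0 : 0 < r by exact: lt_le_trans r1.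
have -> : r ^+ k = expR (k%:R * ln r) by rewrite mulrC expRM_natr lnK.
rewrite -expRD ler_expR.
have := psi_star_lower k mono_phi lim_phi r1; lra.
Qed.

Lemma enorm_coord (R : realType) (n : nat) (x : 'rV[R]_n) i : `|x 0 i| <= enorm x.
Proof.
rewrite /enorm -sqrtr_sqr ler_wsqrtr// (bigD1 i)//= lerDl.
by apply: sumr_ge0 => j _; exact: sqr_ge0.
Qed.

Lemma enorm_ge0 (R : realType) (n : nat) (x : 'rV[R]_n) : 0 <= enorm x.
Proof. exact: sqrtr_ge0. Qed.

Definition revec (R : realType) (n : nat) (z : 'rV[R[i]]_n) : 'rV[R]_n :=
  \row_(i < n) complex.Re (z 0 i).

(** The product form separates the factor paid for by the decay of [f] from the one paid for by
    growth of the weights. *)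
Lemma cenorm_le (R : realType) (n : nat) (z : 'rV[R[i]]_n) :
  1 + cenorm z <= (1 + enorm (revec z)) * (1 + enorm (imvec z)).
Proof.
have h0 := enorm_ge0 (revec z); have h1 := enorm_ge0 (imvec z).
suff h : cenorm z <= enorm (revec z) + enorm (imvec z).
  by have := mulr_ge0 h0 h1; lra.
rewrite -[leRHS]ger0_norm ?addr_ge0// -sqrtr_sqr ler_wsqrtr//.
have sq (x : 'rV[R]_n) : enorm x ^+ 2 = \sum_i x 0 i ^+ 2.
  by rewrite sqr_sqrtr// sumr_ge0// => i _; exact: sqr_ge0.
rewrite sqrrD !sq addrAC -big_split/= (@le_trans _ _ (\sum_i (revec z 0 i ^+ 2 + imvec z 0 i ^+ 2)))//.
  apply: ler_sum => i _; rewrite !mxE; case: (z 0 i) => a b /=.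
  by rewrite sqr_sqrtr ?addr_ge0 ?sqr_ge0.
by rewrite lerDl mulrn_wge0// mulr_ge0.
Qed.

Lemma normc_mono_le (R : realType) (n : nat) (a : {ffun 'I_n -> nat})
    (z : 'rV[R[i]]_n) (rho : R) : (forall i, Normc.normc (z 0 i) <= rho) ->
  Normc.normc (mono a z) <= rho ^+ mabs a.
Proof.
move=> zr; rewrite -lecR -normr_normc /mono normr_prod rmorphXn /mabs -prodrXr.
apply: ler_prod => i _; rewrite normr_ge0 normrX /=.
by rewrite lerXn2r ?nnegrE ?normr_ge0 ?lecR// (le_trans (normc_ge0 _) (zr i)).
Qed.

Lemma mono_cembed (R : realType) (n : nat) (a : {ffun 'I_n -> nat})
    (x : 'rV[R]_n) : mono a (cembed x) = (mono a x)%:C.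
Proof.
rewrite /mono rmorph_prod; apply: eq_bigr => i _.
by rewrite mxE rmorphXn.
Qed.

Lemma entire_shift (K : numFieldType) (n : nat) (F : 'rV[K]_n -> K) (a : 'rV[K]_n) :
  entire F -> entire (fun z => F (z - a)).
Proof.
move=> dF z.
apply: (@differentiable_comp K _ _ _ (fun y => y - a) F); last exact: dF.
by apply: differentiableB.
Qed.

(** [fB] is the seminorm bound freed of the Young conjugate: a Cauchy-type estimate at every radius
    [r >= 1]. *)
Section extension.
Variables (R : realType) (n : nat) (phi : R -> R) (f : 'rV[R]_n -> R[i]).
Hypothesis fs : smooth f.
Hypothesis fB : forall m : nat, exists2 C : R, 0 <= C &
  forall x (a : {ffun 'I_n -> nat}) (r : R), 1 <= r ->
    (1 + enorm x) ^+ m * Normc.normc (mderiv a f x) * r ^+ mabs a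
      <= C * (mfact a)%:R * expR (phi r).

Let coef (x : 'rV[R]_n) (a : {ffun 'I_n -> nat}) : R[i] :=
  mderiv a f x * ((mfact a)%:R^-1)%:C.

Let mfact_gt0 (a : {ffun 'I_n -> nat}) : 0 < (mfact a)%:R :> R.
Proof. by rewrite ltr0n /mfact prodn_gt0// => i; exact: fact_gt0. Qed.

Let normc_coef x a : Normc.normc (coef x a) = Normc.normc (mderiv a f x) / (mfact a)%:R.
Proof.
rewrite /coef Normc.normcM; congr (_ * _).
by rewrite /= expr0n addr0 sqrtr_sqr ger0_norm// invr_ge0 ltW.
Qed.

Let coef_le (m : nat) : exists2 C : R, 0 <= C & forall x a (r : R), 1 <= r ->
  (1 + enorm x) ^+ m * Normc.normc (coef x a) * r ^+ mabs a <= C * expR (phi r).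
Proof.
have [C C0 H] := fB m; exists C => // x a r r1.
rewrite normc_coef [leLHS](_ : _ =
  ((1 + enorm x) ^+ m * Normc.normc (mderiv a f x) * r ^+ mabs a) / (mfact a)%:R).
  by rewrite ler_pdivrMr// [leRHS]mulrAC; exact: H.
by ring.
Qed.

(** The series is kept in the conclusion because growth is later read off from its partial sums. *)
Lemma taylor_extension (x : 'rV[R]_n) : exists F : 'rV[R[i]]_n -> R[i],
  [/\ entire F, extends F f &
     forall z, ccvg (fun N => cube_sum N (fun a => coef x a * mono a (z - cembed x))) (F z)].
Proof.
have [C C0 H] := coef_le 0.
have [|P [Pe PE]] := @power_series_entire R n (coef x).
  move=> r r1; exists (C * expR (phi r)); first by rewrite mulr_ge0 ?expR_ge0.
  by move=> a; have := H x a r r1; rewrite expr0 mul1r.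
exists (fun z => P (z - cembed x)); split=> [|y|z].
- exact: entire_shift.
- pose h := y - x.
  have hE : cembed y - cembed x = cembed h.
    by apply/rowP => i; rewrite !mxE rmorphB.
  rewrite hE; apply: ccvg_unique (PE _) _.
  pose s := \sum_i `|h 0 i|.
  have s0 : 0 <= s by apply: sumr_ge0.
  (* Estimates hold at every radius, so [r] may depend on [y]; this choice puts each coordinate of
     [h] within [r / 2]. *)
  pose r := 1 + 2 * s.
  have r1 : 1 <= r by rewrite lerDl mulr_ge0.
  have r0 : 0 < r by exact: lt_le_trans r1.
  pose q : R := 2^-1.
  have q01 : 0 <= q < 1 by rewrite /q invr_ge0 ler0n invf_lt1// ltr1n.
  have hq i : `|h 0 i| <= q * r.
    rewrite /q /r mulrDr mulrA mulVf// mul1r mulr1 /s (bigD1 i)//=.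
    have : 0 <= \sum_(j | j != i) `|h 0 j| by apply: sumr_ge0.
    lra.
  pose B := C * expR (phi r).
  have B0 : 0 <= B by rewrite mulr_ge0// expR_ge0.
  have bnd (a : {ffun 'I_n -> nat}) t :
      Normc.normc (mderiv a f t) * r ^+ mabs a <= B * (mfact a)%:R.
    have := H t a r r1; rewrite expr0 mul1r normc_coef mulrAC.
    by rewrite ler_pdivrMr.
  have rn (a : {ffun 'I_n -> nat}) : 0 <= r ^+ mabs a by rewrite exprn_ge0// ltW.
  pose u t := complex.Re (f t); pose v t := complex.Im (f t).
  have uB a t : `|mderiv_real a u t| * r ^+ mabs a <= B * (mfact a)%:R.
    apply: le_trans (bnd a t); rewrite ler_wpM2r//.
    exact: (Re_le_normc (mderiv a f t)).
  have vB a t : `|mderiv_real a v t| * r ^+ mabs a <= B * (mfact a)%:R.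
    apply: le_trans (bnd a t); rewrite ler_wpM2r//.
    exact: (Im_le_normc (mderiv a f t)).
  (* The factor 2 adds the Taylor errors of the real and imaginary parts. *)
  pose K := 2 * (n%:R * (B * ((1 - q)^-1) ^+ n)).
  have K0 : 0 <= K.
    rewrite /K !mulr_ge0// exprn_ge0// invr_ge0 subr_ge0.
    by case/andP: q01 => _ /ltW.
  have main N : Normc.normc (cube_sum N (fun a => coef x a * mono a (cembed h)) - f y)
      <= K * q ^+ N.+1.
    pose D (w : 'rV[R]_n -> R) :=
      cube_sum N (fun b => mderiv_real b w x * (mono b h / (mfact b)%:R)).
    have sE : cube_sum N (fun a => coef x a * mono a (cembed h)) = D u +i* D v.
      rewrite /D /cube_sum.
      have -> (I : finType) (g1 g2 : I -> R) : (\sum_i g1 i) +i* (\sum_i g2 i) =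
          \sum_i (g1 i +i* g2 i).
        by apply: (big_rec3 (fun a b c => a +i* b = c)) => // i y1 y2 y3 _ <-.
      apply: eq_bigr => b _; rewrite /coef /mderiv mono_cembed -mulrA -rmorphM.
      rewrite [_^-1 * _]mulrC; simpc.
      by [].
    have xh : x + h = y by rewrite /h addrC subrK.
    have h1 := cube_taylor N fs.1 B0 r0 q01 uB x hq.
    have h2 := cube_taylor N fs.2 B0 r0 q01 vB x hq.
    rewrite xh distrC in h1; rewrite xh distrC in h2.
    rewrite sE (_ : _ - f y = (D u - u y) +i* (D v - v y)); last first.
      by rewrite /u /v; case: (f y).
    apply: le_trans (normc_le_sum _ _) (le_trans (lerD h1 h2) _).
    by rewrite /K le_eqVlt; apply/orP; left; apply/eqP; ring.
  move=> e e0; have [N0 hN0] := ltr_half_expn K e0.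
  exists N0 => // N /= N0N; apply: (le_trans (main N)); apply: le_trans (ltW hN0).
  rewrite /q exprVn ler_pdivrMr ?exprn_gt0// mulrAC ler_pdivlMr ?exprn_gt0//.
  by rewrite ler_wpM2l// ler_eXn2l ?ltr1n// leqW.
- exact: PE.
Qed.

(** Centred at the real part of [z], the monomials see only the imaginary part, while the
    coefficients carry the decay at that centre. *)
Lemma extension_bound (F : 'rV[R[i]]_n -> R[i]) (q : R) (m : nat) :
  0 < q < 1 -> entire F -> extends F f ->
  exists2 C : R, 0 <= C & forall z (r : R), 1 <= r -> enorm (imvec z) <= q * r ->
    Normc.normc (F z) * (1 + enorm (revec z)) ^+ m <= C * expR (phi r).
Proof.
move=> /andP[q0 q1] Fe Ff; have [C C0 H] := coef_le m.
have q01 : 0 <= q < 1 by rewrite (ltW q0).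
exists (C * ((1 - q)^-1) ^+ n).
  by rewrite mulr_ge0// exprn_ge0// invr_ge0 subr_ge0 ltW.
move=> z r r1 yr; have [G [Ge Gf GE]] := taylor_extension (revec z).
have -> : F = G by apply: entire_real_unique => // x; rewrite Ff Gf.
set t := 1 + enorm (revec z).
have t0 : 0 < t ^+ m by rewrite exprn_gt0// ltr_wpDr// enorm_ge0.
rewrite -ler_pdivlMr//.
have -> : C * (1 - q)^-1 ^+ n * expR (phi r) / t ^+ m =
  (C * expR (phi r) / t ^+ m) * (1 - q)^-1 ^+ n by ring.
apply: (ccvg_le (GE z)) => N; apply: normc_cube_sum_le => //.
  by rewrite !mulr_ge0 ?expR_ge0// invr_ge0 ltW.
move=> a; rewrite Normc.normcM.
have hm : Normc.normc (mono a (z - cembed (revec z))) <= (q * r) ^+ mabs a.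
  apply: normc_mono_le => i; apply: le_trans yr.
  apply: le_trans (enorm_coord _ i).
  rewrite !mxE; case: (z 0 i) => x y /=.
  by rewrite subrr expr0n /= add0r subr0 sqrtr_sqr.
apply: (le_trans (ler_wpM2l (normc_ge0 _) hm)).
have := H (revec z) a r r1; rewrite -/t -mulrA => h.
rewrite exprMn [leLHS](_ : _ = Normc.normc (coef (revec z) a) * r ^+ mabs a * q ^+ mabs a).
  rewrite ler_wpM2r ?exprn_ge0 ?(ltW q0)// ler_pdivlMr//.
  by rewrite mulrC.
by ring.
Qed.

End extension.

Theorem theorem2 (R : realType) (n : nat) (n_gt0 : (0 < n)%N)
  (Phi : nat -> R -> R)
  (Phi_nondecreasing : forall m, (0 < m)%N ->
     forall x y : R, 0 <= x -> x <= y -> Phi m x <= Phi m y)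
  (Phi_continuous : forall m, (0 < m)%N ->
     {within [set x : R | 0 <= x], continuous (Phi m)})
  (i1 : forall m, (0 < m)%N -> Phi m x / x @[x --> +oo] --> +oo)
  (i2 : forall m, (0 < m)%N -> forall A : R, 0 < A ->
     exists C : R, 0 < C /\
       forall x : R, 0 <= x -> Phi m x + A * ln (1 + x) <= Phi m.+1 x + C)
  (i4 : forall m, (0 < m)%N ->
     exists sigma gamma : R, [/\ 1 < sigma, 0 < gamma &
       forall x : R, 0 <= x -> Phi m (sigma * x) <= Phi m.+1 x + gamma])
  (f : 'rV[R]_n -> R[i]) (fE : calE_family (psi_star Phi) f) :
  (exists! F : 'rV[R[i]]_n -> R[i], entire F /\ extends F f) /\
  (forall F : 'rV[R[i]]_n -> R[i],
     entire F -> extends F f -> E_family Phi F).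
Proof.
have [nu nu0 fnu] := fE.
have nu1 : (0 < nu.+1)%N by [].
pose phi := Phi nu.
have phi_mono (k : nat) : (0 < k)%N ->
    forall x y : R, 0 <= x -> x <= y -> Phi k x <= Phi k y.
  exact: Phi_nondecreasing.
have fs : smooth f by have [] := calE_mP (fnu 0%N I).
have fB (m : nat) : exists2 C : R, 0 <= C &
  forall x (a : {ffun 'I_n -> nat}) (r : R), 1 <= r ->
    (1 + enorm x) ^+ m * Normc.normc (mderiv a f x) * r ^+ mabs a
      <= C * (mfact a)%:R * expR (phi r).
  have [_ [C C0 H]] := calE_mP (fnu m I); exists C => // x a r r1.
  have rk : 0 <= r ^+ mabs a by rewrite exprn_ge0// (le_trans ler01).
  apply: le_trans (ler_wpM2r rk (H x a)) _.
  rewrite -!mulrA !ler_wpM2l//.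
  by apply: expR_psi_star_le => //; [exact: phi_mono|exact: i1].
have member F : entire F -> extends F f -> E_family Phi F.
  move=> Fe Ff; exists nu.+2 => // k _; split=> //.
  have [sigma [gamma [s1 g0 hs]]] := i4 nu nu0.
  (* [i2] asks for a positive exponent and [k] may be 0, hence [k.+1]. *)
  have k0 : 0 < (k.+1%:R : R) by rewrite ltr0n.
  have [C' [C'0 hC']] := i2 _ nu1 _ k0.
  have s0 : 0 < sigma by exact: lt_trans s1.
  have q01 : 0 < sigma^-1 < 1 by rewrite invr_gt0 s0 invf_lt1.
  have [C C0 HC] := extension_bound fs fB k q01 Fe Ff.
  (* The last two terms cover [sigma * y < 1]: there [r = 1], and [Phi nu.+1 y >= Phi nu.+1 0]. *)
  pose g := gamma + `|Phi nu 1| + `|Phi nu.+1 0|.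
  apply: (@le_lt_trans _ _ (C * expR (g + C'))%:E); last exact: ltry.
  apply: ub_ereal_sup => _ [z _ <-]; rewrite lee_fin.
  set y := enorm (imvec z); have y0 : 0 <= y by exact: enorm_ge0.
  rewrite ler_pdivrMr ?expR_gt0//.
  pose r := Num.max 1 (sigma * y).
  have r1 : 1 <= r by rewrite le_max lexx.
  have yr : y <= sigma^-1 * r.
    by rewrite mulrC ler_pdivlMr// mulrC le_max lexx orbT.
  have hr : Phi nu r <= Phi nu.+1 y + g.
    have n1 := ler_norm (Phi nu 1); have n2 := ler_norm (- Phi nu.+1 0).
    rewrite normrN in n2.
    have m1 := normr_ge0 (Phi nu 1); have m2 := normr_ge0 (Phi nu.+1 0).
    have p0 := phi_mono _ nu1 _ _ (lexx 0) y0.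
    rewrite /g /r; have [_|_] := leP 1 (sigma * y); last lra.
    have := hs y y0; lra.
  have x0 := enorm_ge0 (revec z).
  have zle : (1 + cenorm z) ^+ k <=
      (1 + enorm (revec z)) ^+ k * (1 + y) ^+ k.
    have c0 : 0 <= cenorm z by exact: sqrtr_ge0.
    by rewrite -exprMn lerXn2r ?nnegrE ?mulr_ge0 ?addr_ge0// cenorm_le.
  apply: le_trans (ler_wpM2l (normc_ge0 _) zle) _.
  rewrite mulrA; have yk : 0 <= (1 + y) ^+ k by rewrite exprn_ge0// addr_ge0.
  apply: le_trans (ler_wpM2r yk (HC z r r1 yr)) _.
  rewrite -!mulrA ler_wpM2l// -expRD.
  have y1 : 0 < 1 + y by rewrite ltr_pwDl.
  have -> : (1 + y) ^+ k = expR (k%:R * ln (1 + y)) by rewrite mulrC expRM_natr lnK.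
  rewrite -expRD ler_expR.
  have l0 : 0 <= ln (1 + y) by rewrite ln_ge0// lerDl.
  have := hC' y y0; rewrite -natr1 mulrDl mul1r /phi; lra.
split=> //.
have [F [Fe Ff _]] := taylor_extension fs fB 0.
exists F; split=> // G [Ge Gf].
by apply: entire_real_unique => // x; rewrite Ff Gf.
Qed.
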